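(* For an operadic equivalence $f:D\to D'$ of dendroidal sets, the induced morphisms $f_*:K_n(D)\to K_n(D')$ are isomorphisms. Hence the $K$-groups are an invariant of $\infty$-operads.
   Context: **Trees and dendroidal sets.** ''Operad'' means coloured symmetric operad. Objects of the category $\Omega$ are finite rooted trees (including the tree $L_0=|$ with one edge and no vertex; vertices with no inputs are allowed). Each tree $T$ generates a free coloured symmetric operad $\Omega(T)$, with colours the edges of $T$ and one generating operation per vertex, from its input edges to its output edge. Morphisms $S\to T$ in $\Omega$ are operad morphisms $\Omega(S)\to\Omega(T)$. A dendroidal set is a presheaf of sets on $\Omega$; the category is $\mathrm{dSet}$; $\Omega[T]$ is the presheaf represented by $T$. Viewing $[n]$ as the linear tree $L_n$ with $n$ vertices gives $\Delta\subset\Omega$ and restriction $i^*:\mathrm{dSet}\to\mathrm{sSet}$. The corolla $C_n$ is the tree with one vertex, $n$ leaves and a root. **Horns and model structures.** If $T$ has at least two vertices, its faces are: inner faces (contract an inner edge) and outer faces (chop off an outer vertex, i.e. a vertex attached to exactly one inner edge, together with its outer edges). The faces of $C_n$ are the $n+1$ inclusions of its edges. The boundary $\partial\Omega[T]\subset\Omega[T]$ is the union of all faces; the horn $\Lambda^a[T]$ is the union of all faces except the one labelled $a$ (for $C_n$: all but one of the $n+1$ edges); it is inner if $a$ is an inner edge. $D$ is an $\infty$-operad (inner Kan) if every map $\Lambda^e[T]\to D$ from an inner horn extends to $\Omega[T]$, and fully Kan if this holds for all horns. Normal monomorphisms are the smallest class containing all $\partial\Omega[T]\to\Omega[T]$ and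 closed under pushouts, retracts and transfinite composition. The Cisinski-Moerdijk model structure on $\mathrm{dSet}$ is the (unique) one with cofibrations the normal monomorphisms and fibrant objects the $\infty$-operads; its weak equivalences are the operadic equivalences. The stable model structure has the same cofibrations and fibrant objects the fully Kan dendroidal sets; it is a left Bousfield localization of the former. **$K$-groups.** $K_n(D):=\pi_n(i^*D_K)$, where $D\to D_K$ is a (functorial) fibrant replacement in the stable model structure. The choice of base point is inessential since $i^*D_K$ is an infinite loop space. *)

(* Defs.v *)
From mathcomp Require Import all_boot.
From mathcomp Require Import boolp.

Set Implicit Arguments.
Unset Strict Implicit.
Unset Printing Implicit Defensive.

(* One fixed universe for hom-sets, for the values of presheaves, and for the
   index sets of transfinite compositions. *)
Definition SET := Type.
Identity Coercion Type_of_SET : SET >-> Sortclass.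

(* Coordinate-free presentation: the inputs of an operation are indexed by an
   arbitrary finite set I, [op c e] being the set of operations with inputs
   c i (i in I) and output e.  Bijections J -> I act by relabelling the inputs
   (for I = J = {1..n} this is the right action of the symmetric group), and
   the inputs of a composite are indexed by the disjoint union. *)
Record operad_data := OperadData {
  colour : Type;
  op : forall I : finType, (I -> colour) -> colour -> Type;
  op_id : forall e, op (fun _ : unit => e) e;
  op_comp : forall (I : finType) (J : I -> finType) (c : I -> colour)
      (d : forall i, J i -> colour) (e : colour),
    op c e -> (forall i, op (d i) (c i)) ->
    op (fun x : {i : I & J i} => d (tag x) (tagged x)) e;
  op_act : forall (I J : finType) (s : J -> I) (c : I -> colour) (e : colour),
    bijective s -> op c e -> op (fun j => c (s j)) e }.

Arguments op_id : clear implicits.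
Arguments op_id {o} e.

Definition sigT_map (I I' : Type) (J : I -> Type) (J' : I' -> Type)
    (s : I' -> I) (t : forall i, J' i -> J (s i)) (x : {i : I' & J' i}) :
    {i : I & J i} := existT J (s (tag x)) (t (tag x) (tagged x)).

Definition sigT_assoc (I : Type) (J : I -> Type) (K : {i : I & J i} -> Type)
    (x : {i : I & {j : J i & K (existT J i j)}}) : {y : {i : I & J i} & K y} :=
  existT K (existT J (tag x) (tag (tagged x))) (tagged (tagged x)).

Record operad_axioms (P : operad_data) : Prop := OperadAxioms {
  op_act1 : forall (I : finType) (c : I -> colour P) e (b : bijective id)
      (p : op c e), op_act b p = p;
  op_actM : forall (I J K : finType) (s : J -> I) (t : K -> J)
      (c : I -> colour P) e (bs : bijective s) (bt : bijective t)
      (bst : bijective (fun k => s (t k))) (p : op c e),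
    op_act bst p = op_act bt (op_act bs p);
  op_comp1l : forall (J : finType) (d : J -> colour P) e
      (b : bijective (fun x : {i : unit & J} => tagged x)) (q : op d e),
    op_comp (op_id e) (fun _ => q) = op_act b q;
  op_comp1r : forall (I : finType) (c : I -> colour P) e
      (b : bijective (fun x : {i : I & unit} => tag x)) (p : op c e),
    op_comp p (fun i => op_id (c i)) = op_act b p;
  op_compA : forall (I : finType) (J : I -> finType)
      (K : {i : I & J i} -> finType) (c : I -> colour P)
      (d : forall i, J i -> colour P) (f : forall x, K x -> colour P) e
      (b : bijective (@sigT_assoc I J K)) (p : op c e)
      (q : forall i, op (d i) (c i))
      (r : forall x, op (f x) (d (tag x) (tagged x))),
    op_comp p (fun i => op_comp (q i) (fun j => r (existT J i j))) =
    op_act b (op_comp (op_comp p q) r);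
  op_comp_actl : forall (I I' : finType) (J : I -> finType) (s : I' -> I)
      (c : I -> colour P) (d : forall i, J i -> colour P) e (bs : bijective s)
      (b : bijective
             (@sigT_map I I' J (fun i => J (s i)) s (fun _ j => j)))
      (p : op c e) (q : forall i, op (d i) (c i)),
    op_comp (op_act bs p) (fun i => q (s i)) = op_act b (op_comp p q);
  op_comp_actr : forall (I : finType) (J J' : I -> finType)
      (t : forall i, J' i -> J i) (c : I -> colour P)
      (d : forall i, J i -> colour P) e (bt : forall i, bijective (t i))
      (b : bijective (@sigT_map I I J J' id t))
      (p : op c e) (q : forall i, op (d i) (c i)),
    op_comp p (fun i => op_act (bt i) (q i)) = op_act b (op_comp p q) }.

Record operad := Operad {
  operad_of :> operad_data;
  operadP : operad_axioms operad_of }.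

Definition is_operad_hom (P Q : operad) (h0 : colour P -> colour Q)
    (h : forall (I : finType) (c : I -> colour P) e,
       op c e -> op (fun i => h0 (c i)) (h0 e)) : Prop :=
  [/\ forall e, h _ _ _ (op_id e) = op_id (h0 e),
      forall (I : finType) (J : I -> finType) (c : I -> colour P)
        (d : forall i, J i -> colour P) e (p : op c e)
        (q : forall i, op (d i) (c i)),
        h _ _ _ (op_comp p q) = op_comp (h _ _ _ p) (fun i => h _ _ _ (q i))
    & forall (I J : finType) (s : J -> I) (c : I -> colour P) e
        (b : bijective s) (p : op c e),
        h _ _ _ (op_act b p) = op_act b (h _ _ _ p)].

Record operad_hom (P Q : operad) := OperadHom {
  hcol :> colour P -> colour Q;
  hop : forall (I : finType) (c : I -> colour P) e,
    op c e -> op (fun i => hcol (c i)) (hcol e);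
  hopP : is_operad_hom hop }.

Program Definition operad_idm (P : operad) : operad_hom P P :=
  {| hcol := id; hop := fun _ _ _ p => p |}.
Next Obligation. by split. Qed.

Program Definition operad_compm (P Q R : operad) (g : operad_hom Q R)
    (f : operad_hom P Q) : operad_hom P R :=
  {| hcol := fun c => g (f c); hop := fun _ _ _ p => hop g (hop f p) |}.
Next Obligation.
case: g => g0 g [gi gc ga]; case: f => f0 f [fi fc fa]; split=> /=.
- by move=> e; rewrite fi gi.
- by move=> *; rewrite fc gc.
- by move=> *; rewrite fa ga.
Qed.

(* A vertex is identified with its output edge: the vertices are the edges that
   are not leaves, and the inputs of the vertex v are the edges with parent v.
   An edge without children is either a leaf or the output of a vertex without
   inputs.  The root is the only edge without parent. *)
Record tree := Tree {
  edge : finType;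
  parent : edge -> option edge;
  leaf : pred edge;
  leafP : forall e x, parent x = Some e -> ~~ leaf e;
  treeP : exists2 r, parent r = None &
          forall e, exists n, iter n (obind parent) (Some e) = Some r }.

Section TreeOperad.
Variable T : tree.

(* Operations of the free operad on the vertices of T.  That operad has at most
   one operation with given inputs and output (a subtree is determined by its
   leaves and its root), so it is described by the relation "there is an
   operation with inputs c and output e". *)
Inductive tree_op :
    forall I : finType, (I -> edge T) -> edge T -> Prop :=
| TreeOpId e : tree_op (fun _ : unit => e) e
| TreeOpVertex v : ~~ leaf v ->
    tree_op (fun x : {x : edge T | parent x == Some v} => val x) v
| TreeOpComp (I : finType) (J : I -> finType) (c : I -> edge T)
    (d : forall i, J i -> edge T) e :
    tree_op c e -> (forall i, tree_op (d i) (c i)) ->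
    tree_op (fun x : {i : I & J i} => d (tag x) (tagged x)) e
| TreeOpAct (I J : finType) (s : J -> I) (c : I -> edge T) e :
    bijective s -> tree_op c e -> tree_op (fun j => c (s j)) e.

Definition tree_operad_data : operad_data :=
  @OperadData (edge T) tree_op TreeOpId TreeOpComp TreeOpAct.

Lemma tree_operad_axioms : operad_axioms tree_operad_data.
Proof. by split=> /= *; apply: Prop_irrelevance. Qed.

Definition tree_operad : operad := Operad tree_operad_axioms.

End TreeOperad.

Arguments tree_op T [I] c e.

Record category := Category {
  ob : Type;
  hom : ob -> ob -> SET;
  idm : forall a, hom a a;
  compm : forall a b c, hom b c -> hom a b -> hom a c;
  compm1 : forall a b (f : hom a b), compm f (idm a) = f;
  comp1m : forall a b (f : hom a b), compm (idm b) f = f;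
  compmA : forall a b c d (h : hom c d) (g : hom b c) (f : hom a b),
    compm h (compm g f) = compm (compm h g) f }.

Arguments idm {_} a.
Arguments compm {_ a b c}.

Lemma operad_hom_eq (P Q : operad) (h0 : colour P -> colour Q)
    (h : forall (I : finType) (c : I -> colour P) e,
       op c e -> op (fun i => h0 (c i)) (h0 e)) (p q : is_operad_hom h) :
  OperadHom p = OperadHom q.
Proof. by rewrite (Prop_irrelevance p q). Qed.

Definition tree_hom (S T : tree) : SET :=
  operad_hom (tree_operad S) (tree_operad T).

Program Definition Omega : category :=
  {| ob := tree; hom := tree_hom;
     idm := fun T => operad_idm (tree_operad T);
     compm := fun R S T g f => operad_compm g f |}.
Next Obligation. by case: f => f0 f p; apply: operad_hom_eq. Qed.
Next Obligation. by case: f => f0 f p; apply: operad_hom_eq. Qed.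
Next Obligation. by apply: operad_hom_eq. Qed.

Record presheaf (C : category) := Presheaf {
  psh :> ob C -> SET;
  psh_map : forall a b, hom a b -> psh b -> psh a;
  psh_id : forall a (x : psh a), psh_map (idm a) x = x;
  psh_comp : forall a b c (g : hom b c) (f : hom a b) (x : psh c),
    psh_map (compm g f) x = psh_map f (psh_map g x) }.

Record pmap (C : category) (X Y : presheaf C) := PMap {
  pmap_at :> forall a, X a -> Y a;
  pmap_nat : forall a b (f : hom a b) (x : X b),
    pmap_at (psh_map f x) = psh_map f (pmap_at x) }.

Arguments pmap_at {C X Y} p {a}.

Program Definition pid (C : category) (X : presheaf C) : pmap X X :=
  {| pmap_at := fun _ x => x |}.

Program Definition pcomp (C : category) (X Y Z : presheaf C)
    (g : pmap Y Z) (f : pmap X Y) : pmap X Z :=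
  {| pmap_at := fun _ x => g _ (f _ x) |}.
Next Obligation. by rewrite !pmap_nat. Qed.

Program Definition yoneda (C : category) (a : ob C) : presheaf C :=
  {| psh := fun b => hom b a; psh_map := fun _ _ f g => compm g f |}.
Next Obligation. exact: compm1. Qed.
Next Obligation. exact: compmA. Qed.

Record sieve (C : category) (a : ob C) := Sieve {
  in_sieve :> forall b, hom b a -> Prop;
  sieveP : forall b b' (g : hom b a) (f : hom b' b),
    in_sieve g -> in_sieve (compm g f) }.

Arguments in_sieve {C a} s {b} g.

Program Definition sieve_psh (C : category) (a : ob C) (s : sieve a) :
    presheaf C :=
  {| psh := fun b => {g : hom b a | s b g};
     psh_map := fun _ _ f g =>
       exist _ (compm (sval g) f) (sieveP f (svalP g)) |}.
Next Obligation. by apply: eq_exist; exact: compm1. Qed.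
Next Obligation. by apply: eq_exist; exact: compmA. Qed.

Program Definition sieve_incl (C : category) (a : ob C) (s : sieve a) :
    pmap (sieve_psh s) (yoneda a) :=
  {| pmap_at := fun _ g => sval g |}.

Record functor (C D : category) := Functor {
  fob :> ob C -> ob D;
  fmap : forall a b, hom a b -> hom (fob a) (fob b);
  fmap1 : forall a, fmap (idm a) = idm (fob a);
  fmapM : forall a b c (g : hom b c) (f : hom a b),
    fmap (compm g f) = compm (fmap g) (fmap f) }.

Program Definition restr (C D : category) (F : functor C D) (X : presheaf D) :
    presheaf C :=
  {| psh := fun a => X (F a); psh_map := fun _ _ f => psh_map (fmap F f) |}.
Next Obligation. by rewrite fmap1 psh_id. Qed.
Next Obligation. by rewrite fmapM psh_comp. Qed.

Program Definition restr_map (C D : category) (F : functor C D)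
    (X Y : presheaf D) (f : pmap X Y) : pmap (restr F X) (restr F Y) :=
  {| pmap_at := fun a x => f (F a) x |}.
Next Obligation. by rewrite pmap_nat. Qed.

Section TreeTheory.
Variable T : tree.
Implicit Types x y e v : edge T.

Lemma parent_ind (P : edge T -> Prop) :
  (forall x, (forall y, parent x = Some y -> P y) -> P x) -> forall x, P x.
Proof.
move=> IH x; have [r r0 Hr] := treeP T; have [n] := Hr x.
elim: n x => [|n IHn] x.
  by move=> [->]; apply: IH => y; rewrite r0.
rewrite iterSr /= => H; apply: IH => y xy; apply: IHn.
by rewrite -H xy.
Qed.

Lemma root_unique x y : parent x = None -> parent y = None -> x = y.
Proof.
have [r r0 Hr] := treeP T.
suff H z : parent z = None -> z = r by move=> /H-> /H->.
move=> z0; have [[|n] Hn] := Hr z; first by case: Hn.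
have iterN m : iter m (obind (@parent T)) None = None by elim: m => //= m ->.
by rewrite iterSr /= z0 iterN in Hn.
Qed.

Lemma parent_irr x : parent x != Some x.
Proof.
apply/eqP => xx; have [r r0 Hr] := treeP T; have [n] := Hr x.
have -> : iter n (obind (@parent T)) (Some x) = Some x.
  by elim: n => //= n ->.
by move=> [xr]; rewrite xr r0 in xx.
Qed.

Lemma tree_op_reindex (I J : finType) (s : J -> I) (c : I -> edge T)
    (d : J -> edge T) e :
  injective s -> (forall i, exists j, s j = i) -> (forall j, d j = c (s j)) ->
  tree_op T c e -> tree_op T d e.
Proof.
move=> s_inj s_surj dE ce; have -> : d = fun j => c (s j) by apply: funext.
apply: TreeOpAct ce.
have s_surjb i : exists j, s j == i.
  by have [j <-] := s_surj i; exists j.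
exists (fun i => xchoose (s_surjb i)) => [j|i].
  by apply: s_inj; apply/eqP; apply: (xchooseP (s_surjb (s j))).
by apply/eqP; apply: (xchooseP (s_surjb i)).
Qed.

End TreeTheory.

(* The operad of S is free on the vertices of S: a map of edges extends to a
   morphism as soon as it sends every vertex to an operation. *)
Section TreeHom.
Variables (S T : tree) (f : edge S -> edge T).
Hypothesis f_vertex : forall v, ~~ leaf v ->
  tree_op T (fun x : {x : edge S | parent x == Some v} => f (val x)) (f v).

Lemma tree_hom_op (I : finType) (c : I -> edge S) e :
  tree_op S c e -> tree_op T (fun i => f (c i)) (f e).
Proof.
elim=> {I c e} [e|v /f_vertex //|I J c d e _ IHc _ IHd|I J s c e bs _ IH].
- exact: TreeOpId.
- exact: (TreeOpComp IHc IHd).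
- exact: (TreeOpAct bs IH).
Qed.

Lemma tree_hom_ofP :
  @is_operad_hom (tree_operad S) (tree_operad T) f tree_hom_op.
Proof. by split=> /= *; apply: Prop_irrelevance. Qed.

Definition tree_hom_of : tree_hom S T := OperadHom tree_hom_ofP.

End TreeHom.

(* The linear tree with n vertices; its edges are numbered from the leaf 0 to
   the root n. *)
Section Linear.
Variable n : nat.

Definition linear_parent (i : 'I_n.+1) : option 'I_n.+1 := insub i.+1.

Lemma linear_parentE (i j : 'I_n.+1) :
  (linear_parent i == Some j) = (i.+1 == j :> nat).
Proof.
apply/eqP/eqP => [|ij].
  by rewrite /linear_parent; case: insubP => // k _ <- [->].
by rewrite /linear_parent ij valK.
Qed.

Definition linear_leaf : pred 'I_n.+1 := fun i => i == 0 :> nat.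

Lemma linear_leafP (e x : 'I_n.+1) : linear_parent x = Some e -> ~~ linear_leaf e.
Proof. by move/eqP; rewrite linear_parentE /linear_leaf => /eqP <-. Qed.

Lemma linear_treeP : exists2 r, linear_parent r = None &
  forall e, exists m, iter m (obind linear_parent) (Some e) = Some r.
Proof.
exists ord_max; first by rewrite /linear_parent insubF //= ltnn.
move=> e; exists (n - e).
have [k] : {k | k = n - e} by exists (n - e).
move=> kE; rewrite -kE; elim: k e kE => [|k IH] e kE.
  congr Some; apply/val_inj => /=; apply/eqP.
  by rewrite eqn_leq -ltnS ltn_ord /= -subn_eq0 -kE.
have en : e.+1 < n.+1 by rewrite ltnS -subn_gt0 -kE.
rewrite iterSr /=.
have /eqP -> : linear_parent e == Some (Ordinal en) by rewrite linear_parentE.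
by apply: IH => /=; rewrite subnS -kE.
Qed.

Definition linear : tree := Tree linear_leafP linear_treeP.

Lemma linear_op (I : finType) (c : I -> 'I_n.+1) (e : 'I_n.+1) :
  tree_op linear c e <-> (exists i0 : I, (forall i, i = i0) /\ c i0 <= e).
Proof.
split.
  elim=> {I c e} [e|v nlv|I J c d e _ [i0 [iE ce]] _ IH|I J s c e [t st ts] _ [i0 [iE ce]]].
  - by exists tt; split=> // -[].
  - have v0 : 0 < (v : nat) by rewrite lt0n.
    have vn : (v : nat).-1 < n.+1 by rewrite (leq_ltn_trans (leq_pred _)).
    have Hv : @parent linear (Ordinal vn) == Some v.
      by rewrite [_ == _]linear_parentE /= prednK.
    exists (exist _ (Ordinal vn) Hv); split=> [[x Hx]|].
      apply/val_inj/val_inj => /=; move: Hx.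
      by rewrite [_ == _]linear_parentE => /eqP <-.
    by rewrite /= leq_pred.
  - have [j0 [jE dj]] := IH i0.
    exists (existT J i0 j0); split=> [[i j]|]; last exact: leq_trans dj ce.
    by move: j; rewrite (iE i) => j; rewrite (jE j).
  - exists (t i0); split=> [j|]; first by rewrite -(iE (s j)) st.
    by rewrite ts.
move=> [i0 [iE]].
have [k] : {k | k = e - c i0} by exists (e - c i0).
elim: k e => [|k IH] e kE ce.
  have cE : c i0 = e.
    by apply/val_inj/eqP; rewrite eqn_leq ce /= -subn_eq0 -kE.
  apply: (@tree_op_reindex linear unit I (fun=> tt) (fun=> e) c e _ _ _
            (TreeOpId (T := linear) e)).
  - by move=> i j _; rewrite (iE i) (iE j).
  - by case; exists i0.
  - by move=> i; rewrite (iE i).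
have lt_ce : c i0 < e by rewrite -subn_gt0 -kE.
have e0 : 0 < (e : nat) by apply: leq_ltn_trans lt_ce.
have en : (e : nat).-1 < n.+1 by rewrite (leq_ltn_trans (leq_pred _)).
have nle : ~~ @leaf linear e by rewrite /= /linear_leaf -lt0n.
have He : @parent linear (Ordinal en) == Some e.
  by rewrite [_ == _]linear_parentE /= prednK.
have xE (x : {x : edge linear | parent x == Some e}) : val x = Ordinal en.
  apply/val_inj; move: (valP x); rewrite [_ == _]linear_parentE => /eqP.
  by move=> /= <-.
have opc (x : {x : edge linear | parent x == Some e}) : tree_op linear c (val x).
  rewrite xE; apply: IH => /=; first by rewrite -subn1 subnAC -kE subn1.
  by rewrite -ltnS prednK.
apply: (@tree_op_reindex linear _ I
          (fun i => existT (fun=> I) (exist _ (Ordinal en) He) i)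
          _ c e _ _ _ (TreeOpComp (TreeOpVertex nle) opc)).
- by move=> i j _; rewrite (iE i) (iE j).
- move=> [x j]; exists j; have -> : x = exist _ (Ordinal en) He.
    by apply: val_inj; rewrite xE.
  by [].
- by [].
Qed.

End Linear.

Lemma edge_incl_vertex (T : tree) (e : edge T) (v : edge (linear 0)) :
  ~~ leaf v ->
  tree_op T (fun x : {x : edge (linear 0) | parent x == Some v} => e) e.
Proof. by rewrite /= /linear_leaf ord1. Qed.

Definition edge_incl (T : tree) (e : edge T) : tree_hom (linear 0) T :=
  tree_hom_of (f := fun _ => e) (edge_incl_vertex e).

Definition vertices (T : tree) := #|[pred v : edge T | ~~ leaf v]|.

Definition inner (T : tree) (e : edge T) := ~~ leaf e && (parent e != None).

Definition attached (T : tree) (x v : edge T) :=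
  (x == v) || (parent x == Some v).

(* The vertex v is attached to exactly one inner edge. *)
Definition outer (T : tree) (v : edge T) :=
  ~~ leaf v && (#|[pred x : edge T | attached x v && inner x]| == 1).

Section Contract.
Variables (T : tree) (e : edge T).
Hypothesis e_inner : inner e.

Definition contract_edge : finType := {x : edge T | x != e}.

Definition contract_parent (x : contract_edge) : option contract_edge :=
  obind insub (if parent (val x) == Some e then parent e else parent (val x)).

Definition contract_leaf : pred contract_edge := fun x => leaf (val x).

Lemma contract_parentE (x y : contract_edge) :
  (contract_parent x == Some y) =
  (parent (val x) == Some (val y)) ||
  (parent (val x) == Some e) && (parent e == Some (val y)).
Proof.
rewrite /contract_parent.
have insubE (o : option (edge T)) :
    (obind (insub : _ -> option contract_edge) o == Some y) = (o == Some (val y)).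
  case: o => [z|] //=; apply/eqP/eqP => [|[->]]; last by rewrite valK.
  by case: insubP => // k _ <- [->].
case: ifP => [/eqP xe|_]; rewrite insubE ?orbF //= xe.
case: (Some e =P Some (val y)) => [[ye]|//].
by move: (valP y); rewrite /= -ye eqxx.
Qed.

Lemma contract_leafP (y x : contract_edge) :
  contract_parent x = Some y -> ~~ contract_leaf y.
Proof.
move/eqP; rewrite contract_parentE => /orP[/eqP|/andP[_ /eqP]]; exact: leafP.
Qed.

Lemma contract_treeP : exists2 r, contract_parent r = None &
  forall x, exists n, iter n (obind contract_parent) (Some x) = Some r.
Proof.
have [r r0 _] := treeP T.
have re : r != e.
  by apply: contraTneq e_inner => <-; rewrite /inner r0 eqxx andbF.
pose r' : contract_edge := exist _ r re.
pose reach x := exists n, iter n (obind contract_parent) (Some x) = Some r'.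
exists r'; first by rewrite /contract_parent /= r0.
have step x y : contract_parent x = Some y -> reach y -> reach x.
  by move=> xy [n Hn]; exists n.+1; rewrite iterSr /= xy.
suff H z : (forall x : contract_edge, val x = z -> reach x) /\
           (forall x : contract_edge, parent z = Some (val x) -> reach x).
  by move=> x; apply: (H (val x)).1.
elim/parent_ind: z => z IH; split=> [x xz|x zx]; last exact: (IH _ zx).1.
case zy: (parent z) => [y|]; last first.
  have -> : x = r' by apply/val_inj; rewrite xz; apply: root_unique zy r0.
  by exists 0.
case: (eqVneq y e) => [ye|ye].
  case ew: (parent e) => [w|]; last first.
    by move: e_inner; rewrite /inner ew andbF.
  have we : w != e by apply: contra_eq_neq ew => ->; exact: parent_irr.
  apply: (step _ (exist _ w we)); last by apply: (IH _ zy).2; rewrite ye.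
  by apply/eqP; rewrite contract_parentE /= xz zy ye ew !eqxx orbT.
apply: (step _ (exist _ y ye)); last exact: (IH _ zy).1.
by apply/eqP; rewrite contract_parentE /= xz zy eqxx.
Qed.

Definition contract : tree := Tree contract_leafP contract_treeP.

Lemma contract_vertex (v : edge contract) : ~~ leaf v ->
  tree_op T (fun x : {x : edge contract | parent x == Some v} => val (val x))
    (val v).
Proof.
move=> nlv; have nlvT : ~~ leaf (val v : edge T) by [].
have [ev|nev] := boolP (parent e == Some (val v)); last first.
  have H (x : {x : edge contract | parent x == Some v}) :
      parent (val (val x)) == Some (val v).
    move: (valP x); rewrite [_ == _]contract_parentE (negPf nev) andbF orbF.
    by [].
  apply: (@tree_op_reindex T _ _
    (fun x => exist (fun x : edge T => parent x == Some (val v)) _ (H x))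
    _ _ _ _ _ _ (TreeOpVertex nlvT)) => //.
    by move=> x y [] /val_inj/val_inj.
  move=> [x xv].
  have xe : x != e by apply/eqP => xe; rewrite xe in xv; rewrite xv in nev.
  have Hx : @parent contract (exist _ x xe) == Some v.
    by rewrite [_ == _]contract_parentE /= xv.
  exists (exist (fun x : edge contract => parent x == Some v) _ Hx).
  exact/val_inj.
pose I : finType := {x : edge T | parent x == Some (val v)}.
pose J (i : I) : finType := {y : edge T | if val i == e then parent y == Some e
                                         else y == val i}.
have JP (i : I) (y : edge T) :
    (if val i == e then parent y == Some e else y == val i) ->
    (val i = e /\ parent y = Some e) \/ (val i != e /\ y = val i).
  by case: eqVneq => [ie /eqP|ie /eqP]; [left | right].
have opJ (i : I) : tree_op T (fun y : J i => val y) (val i).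
  rewrite /J; case: (eqVneq (val i) e) => [ie|ie].
    by rewrite ie; apply: TreeOpVertex; case/andP: e_inner.
  apply: (@tree_op_reindex T _ _ (fun=> tt) _ _ _ _ _ _ (TreeOpId (val i))).
  - by move=> x y _; apply: val_inj; rewrite (eqP (valP x)) (eqP (valP y)).
  - by case; exists (exist (fun y => y == val i) (val i) (eqxx _)).
  - by move=> x; rewrite (eqP (valP x)).
have Hp (x : {x : edge contract | parent x == Some v}) :
    {i : I & {y : J i | val y = val (val x)}}.
  have := valP x; rewrite [_ == _]contract_parentE.
  have [xv _|_ /=] := boolP (parent (val (val x)) == Some (val v)).
    have Hy : if val (val x) == e then parent (val (val x)) == Some e
              else val (val x) == val (val x).
      by rewrite eqxx (negPf (valP (val x))).
    exists (exist (fun z : edge T => parent z == Some (val v)) _ xv).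
    by exists (exist _ (val (val x)) Hy).
  case/andP => xe _.
  exists (exist (fun z : edge T => parent z == Some (val v)) _ ev).
  have Hy : if e == e then parent (val (val x)) == Some e
            else val (val x) == e by rewrite eqxx.
  by exists (exist _ (val (val x)) Hy).
pose s (x : {x : edge contract | parent x == Some v}) : {i : I & J i} :=
  existT J (tag (Hp x)) (sval (tagged (Hp x))).
have sE x : val (tagged (s x)) = val (val x) := svalP (tagged (Hp x)).
apply: (@tree_op_reindex T _ _ s _ _ _ _ _ _
          (TreeOpComp (TreeOpVertex nlvT) opJ)).
- move=> x y xy; apply/val_inj/val_inj; rewrite -!sE.
  by rewrite xy.
- move=> [i y].
  have ye : val y != e.
    have [[_ ye]|[ie ->] //] := JP i (val y) (valP y).
    by apply: contra_eq_neq ye => ->; exact: parent_irr.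
  have Hx : @parent contract (exist (fun x => x != e) _ ye) == Some v.
    rewrite [_ == _]contract_parentE /=.
    have [[_ ->]|[ie ->]] := JP i (val y) (valP y).
      by rewrite ev eqxx orbT.
    by rewrite (valP i).
  pose x := exist (fun x : edge contract => parent x == Some v) _ Hx.
  exists x; have := sE x; case: (s _) => i' y' /= yy'.
  have ii' : i' = i.
    have ve : val v != e by apply: contraTneq ev => ->; exact: parent_irr.
    have sep (k : I) (z : edge T) : parent z = Some e -> z = val k -> False.
      move=> ze zk; move: (valP k); rewrite /= -zk ze => /eqP[/esym/eqP].
      by rewrite (negPf ve).
    apply/val_inj.
    have := JP i (val y) (valP y); have := JP i' (val y') (valP y').
    rewrite /= yy' => -[[ie' ye']|[ie' ye']] [[ie ye1]|[ie ye1]].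
    + by rewrite ie ie'.
    + by case: (sep i _ ye' ye1).
    + by case: (sep i' _ ye1 ye').
    + exact: etrans (esym ye') ye1.
  subst i'; congr existT; exact/val_inj.
- by move=> x; rewrite sE.
Qed.

Definition contract_map : tree_hom contract T :=
  tree_hom_of (f := fun x : edge contract => val x) contract_vertex.

End Contract.

Section Chop.
Variables (T : tree) (v : edge T).
Hypothesis v_outer : outer v.

(* The outer edges attached to v are removed. *)
Definition chop_keep (x : edge T) := ~~ (attached x v && ~~ inner x).

Definition chop_edge : finType := {x : edge T | chop_keep x}.

Definition chop_parent (x : chop_edge) : option chop_edge :=
  obind insub (parent (val x)).

(* If v is the root vertex, then v itself is not an edge of the face. *)
Definition chop_leaf : pred chop_edge := fun x => leaf (val x) || (val x == v).

Lemma chop_parentE (x y : chop_edge) :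
  (chop_parent x == Some y) = (parent (val x) == Some (val y)).
Proof.
rewrite /chop_parent; case: (parent (val x)) => [z|] //=.
apply/eqP/eqP => [|[->]]; last by rewrite valK.
by case: insubP => // k _ <- [->].
Qed.

Lemma chop_unique (x y : edge T) :
  attached x v -> inner x -> attached y v -> inner y -> x = y.
Proof.
move=> xv xi yv yi; case/andP: v_outer => _ /eqP c1.
have /card_le1_eqP H : #|[pred x : edge T | attached x v && inner x]| <= 1.
  by rewrite c1.
by apply: H; rewrite inE /= ?xv ?xi ?yv ?yi.
Qed.

Lemma chop_keep_parent (x y : edge T) : parent x = Some y -> y != v -> chop_keep y.
Proof.
move=> xy yv; apply/negP => /andP[]; rewrite /attached (negPf yv) /= => /eqP pyv.
by rewrite /inner (leafP xy) pyv.
Qed.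

Lemma chop_leafP (y x : chop_edge) : chop_parent x = Some y -> ~~ chop_leaf y.
Proof.
move/eqP; rewrite chop_parentE => /eqP xy.
rewrite /chop_leaf negb_or (leafP xy) /=; apply/eqP => yv.
have {}xy : parent (val x) = Some v by rewrite xy; congr Some.
have vv : attached v v by rewrite /attached eqxx.
have xv : attached (val x) v by rewrite /attached xy eqxx orbT.
have := valP x; rewrite /= /chop_keep xv /= negbK => xi.
have := valP y; rewrite /= /chop_keep yv vv /= negbK => vi.
move: (parent_irr v); rewrite -{1}(chop_unique xv xi vv vi).
by rewrite xy eqxx.
Qed.

Lemma chop_treeP : exists2 r, chop_parent r = None &
  forall x, exists n, iter n (obind chop_parent) (Some x) = Some r.
Proof.
have step r x y : chop_parent x = Some y ->
    (exists n, iter n (obind chop_parent) (Some y) = Some r) ->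
    exists n, iter n (obind chop_parent) (Some x) = Some r.
  by move=> xy [n Hn]; exists n.+1; rewrite iterSr /= xy.
have step_up r z : (forall y, parent z = Some y -> forall x : chop_edge,
      val x = y -> exists n, iter n (obind chop_parent) (Some x) = Some r) ->
    forall x y, val x = z -> parent z = Some y -> y != v ->
      exists n, iter n (obind chop_parent) (Some x) = Some r.
  move=> IH x y xz zy yv; have ky := chop_keep_parent zy yv.
  apply: (step _ _ (exist _ y ky)); last exact: IH zy _ _.
  by apply/eqP; rewrite chop_parentE xz zy.
have nlv : ~~ leaf v by case/andP: v_outer.
have vv : attached v v by rewrite /attached eqxx.
have [vi|vni] := boolP (inner v).
  have [r r0 _] := treeP T.
  have kr : chop_keep r.
    rewrite /chop_keep /attached r0 orbF; case: eqVneq => // ->.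
    by rewrite vi.
  exists (exist _ r kr); first by rewrite /chop_parent /= r0.
  move=> x; move: {-1}(val x) (erefl (val x)) => z; move: z x.
  elim/parent_ind => z IH x xz.
  case zy: (parent z) => [y|]; last first.
    by exists 0; congr Some; apply/val_inj; rewrite /= xz; apply: root_unique.
  have [yv|yv] := eqVneq y v; last exact: (step_up _ z IH x y).
  have xv : attached (val x) v by rewrite /attached xz zy yv eqxx orbT.
  have := valP x; rewrite /= /chop_keep xv /= negbK => xi.
  move: (parent_irr v); rewrite -{1}(chop_unique xv xi vv vi).
  by rewrite xz zy yv eqxx.
have v0 : parent v = None.
  by move: vni; rewrite /inner nlv /= negbK => /eqP.
have [i /andP[iv ii]] : exists i, attached i v && inner i.
  case/andP: v_outer => _ /eqP c1.
  have /card_gt0P[i] : 0 < #|[pred x : edge T | attached x v && inner x]|.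
    by rewrite c1.
  by rewrite inE; exists i.
have ki : chop_keep i by rewrite /chop_keep ii andbF.
have piv : parent i = Some v.
  case/orP: iv => [/eqP iv|/eqP //]; by rewrite iv (negPf vni) in ii.
have nkv : chop_keep v = false by rewrite /chop_keep vv vni.
exists (exist _ i ki); first by rewrite /chop_parent /= piv /= insubF.
move=> x; move: {-1}(val x) (erefl (val x)) => z; move: z x.
elim/parent_ind => z IH x xz.
case zy: (parent z) => [y|]; last first.
  by move: (valP x); rewrite /= xz (root_unique zy v0) nkv.
have [yv|yv] := eqVneq y v; last exact: (step_up _ z IH x y).
have xv : attached (val x) v by rewrite /attached xz zy yv eqxx orbT.
have := valP x; rewrite /= /chop_keep xv /= negbK => xi.
by exists 0; congr Some; apply/val_inj; apply: chop_unique.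
Qed.

Definition chop : tree := Tree chop_leafP chop_treeP.

Lemma chop_vertex (w : edge chop) : ~~ leaf w ->
  tree_op T (fun x : {x : edge chop | parent x == Some w} => val (val x))
    (val w).
Proof.
rewrite /= /chop_leaf negb_or => /andP[nlw wv].
have H (x : {x : edge chop | parent x == Some w}) :
    parent (val (val x)) == Some (val w).
  by move: (valP x); rewrite [_ == _]chop_parentE.
apply: (@tree_op_reindex T _ _
  (fun x => exist (fun x : edge T => parent x == Some (val w)) _ (H x))
  _ _ _ _ _ _ (TreeOpVertex nlw)) => //.
  by move=> x y [] /val_inj/val_inj.
move=> [x xw].
have kx : chop_keep x.
  apply/negP => /andP[/orP[/eqP xv|/eqP xv]].
    rewrite /inner xv -xv (eqP xw) andbT negbK xv.
    by apply/negP; case/andP: v_outer.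
  by move: xw wv; rewrite xv => /eqP[->]; rewrite eqxx.
have Hx : @parent chop (exist (fun x => chop_keep x) _ kx) == Some w.
  by rewrite [_ == _]chop_parentE.
exists (exist (fun x : edge chop => parent x == Some w) _ Hx).
exact/val_inj.
Qed.

Definition chop_map : tree_hom chop T :=
  tree_hom_of (f := fun x : edge chop => val x) chop_vertex.

End Chop.

(* Inner edges and outer vertices only exist in trees with at least two
   vertices. *)
Inductive face (T : tree) : Type :=
| InnerFace (e : edge T) of inner e
| OuterFace (v : edge T) of outer v
| CorollaFace (e : edge T) of vertices T == 1.

Definition face_tree (T : tree) (a : face T) : tree :=
  match a with
  | InnerFace _ ei => contract ei
  | OuterFace _ vo => chop vo
  | CorollaFace _ _ => linear 0
  end.

Definition face_map (T : tree) (a : face T) : tree_hom (face_tree a) T :=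
  match a with
  | InnerFace _ ei => contract_map ei
  | OuterFace _ vo => chop_map vo
  | CorollaFace e _ => edge_incl e
  end.

Definition is_inner (T : tree) (a : face T) : bool :=
  if a is InnerFace _ _ then true else false.

Definition dset := presheaf Omega.

Definition face_union_pred (T : tree) (Q : face T -> Prop) (S : ob Omega)
    (g : hom S (T : ob Omega)) : Prop :=
  exists2 a, Q a & exists h : hom S (face_tree a : ob Omega),
    g = compm (face_map a : hom (face_tree a : ob Omega) T) h.

Program Definition face_union (T : tree) (Q : face T -> Prop) :
    sieve (T : ob Omega) :=
  {| in_sieve := @face_union_pred T Q |}.
Next Obligation.
by case: H => a Qa [h ->]; exists a => //; exists (compm h f); rewrite compmA.
Qed.

Definition boundary (T : tree) := face_union (fun _ : face T => True).

Definition horn (T : tree) (a : face T) := face_union (fun b => b <> a).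

Definition extends (D : dset) (T : tree) (s : sieve (T : ob Omega)) : Prop :=
  forall u : pmap (sieve_psh s) D, exists w : pmap (yoneda (T : ob Omega)) D,
    pcomp w (sieve_incl s) = u.

Definition infty_operad (D : dset) : Prop :=
  forall (T : tree) (a : face T), is_inner a -> extends D (horn a).

Definition fully_kan (D : dset) : Prop :=
  forall (T : tree) (a : face T), extends D (horn a).

Section Classes.
Variable C : category.

Definition mclass := forall X Y : presheaf C, pmap X Y -> Prop.

Definition is_pushout (A B X Y : presheaf C) (f : pmap A B) (u : pmap A X)
    (v : pmap B Y) (g : pmap X Y) : Prop :=
  pcomp v f = pcomp g u /\
  forall Z (v' : pmap B Z) (g' : pmap X Z), pcomp v' f = pcomp g' u ->
    exists! w : pmap Y Z, pcomp w v = v' /\ pcomp w g = g'.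

Definition is_retract (A B X Y : presheaf C) (f : pmap A B) (g : pmap X Y)
    : Prop :=
  exists (s : pmap A X) (r : pmap X A) (s' : pmap B Y) (r' : pmap Y B),
    [/\ pcomp r s = pid A, pcomp r' s' = pid B,
        pcomp g s = pcomp s' f & pcomp f r = pcomp r' g].

Definition closed_pushout (P : mclass) : Prop :=
  forall (A B X Y : presheaf C) (f : pmap A B) (u : pmap A X) (v : pmap B Y)
    (g : pmap X Y), is_pushout f u v g -> P _ _ f -> P _ _ g.

Definition closed_retract (P : mclass) : Prop :=
  forall (A B X Y : presheaf C) (f : pmap A B) (g : pmap X Y),
    is_retract f g -> P _ _ g -> P _ _ f.

(* A well-ordered set, playing the role of an ordinal. *)
Record wellorder := WellOrder {
  wo :> SET;
  wlt : wo -> wo -> Prop;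
  wlt_wf : well_founded wlt;
  wlt_trans : forall a b c, wlt a b -> wlt b c -> wlt a c;
  wlt_total : forall a b, wlt a b \/ a = b \/ wlt b a }.

Definition wle (W : wellorder) (a b : W) := a = b \/ wlt a b.

Definition wsucc (W : wellorder) (a b : W) :=
  wlt a b /\ ~ exists c, wlt a c /\ wlt c b.

Definition wlimit (W : wellorder) (b : W) :=
  (exists a, wlt a b) /\ ~ exists a, wsucc a b.

Definition wbottom (W : wellorder) (a : W) := forall b, wle a b.

Record chain (W : wellorder) := Chain {
  ch :> W -> presheaf C;
  ch_map : forall a b, wle a b -> pmap (ch a) (ch b);
  ch_id : forall a (h : wle a a), ch_map h = pid (ch a);
  ch_comp : forall a b c (h : wle a b) (k : wle b c) (l : wle a c),
    ch_map l = pcomp (ch_map k) (ch_map h) }.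

(* Y with the maps iota is the colimit of the restriction of F to Q. *)
Definition is_colimit_on (W : wellorder) (F : chain W) (Q : W -> Prop)
    (Y : presheaf C) (iota : forall a, Q a -> pmap (F a) Y) : Prop :=
  let cocone Z (k : forall a, Q a -> pmap (F a) Z) :=
    forall a b (qa : Q a) (qb : Q b) (h : wle a b),
      pcomp (k b qb) (ch_map F h) = k a qa in
  cocone Y iota /\
  forall Z k, cocone Z k ->
    exists! w : pmap Y Z, forall a (qa : Q a), pcomp w (iota a qa) = k a qa.

Definition closed_transfinite (P : mclass) : Prop :=
  forall (W : wellorder) (F : chain W),
    (forall b, wlimit b -> is_colimit_on (F := F) (Q := fun a => wlt a b)
       (fun a h => ch_map F (or_intror h))) ->
    (forall a b (h : wle a b), wsucc a b -> P _ _ (ch_map F h)) ->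
    forall Y (iota : forall a : W, True -> pmap (F a) Y),
      is_colimit_on iota -> forall a, wbottom a -> P _ _ (iota a I).

Definition lifts (A B X Y : presheaf C) (i : pmap A B) (p : pmap X Y) : Prop :=
  forall (u : pmap A X) (v : pmap B Y), pcomp p u = pcomp v i ->
    exists h : pmap B X, pcomp h i = u /\ pcomp p h = v.

Record model_structure := ModelStructure {
  weq : mclass;
  cof : mclass;
  fib : mclass;
  weq_comp : forall X Y Z (f : pmap X Y) (g : pmap Y Z),
    weq f -> weq g -> weq (pcomp g f);
  weq_cancell : forall X Y Z (f : pmap X Y) (g : pmap Y Z),
    weq f -> weq (pcomp g f) -> weq g;
  weq_cancelr : forall X Y Z (f : pmap X Y) (g : pmap Y Z),
    weq g -> weq (pcomp g f) -> weq f;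
  weq_retract : closed_retract weq;
  cof_retract : closed_retract cof;
  fib_retract : closed_retract fib;
  cof_tfib_lifts : forall A B X Y (i : pmap A B) (p : pmap X Y),
    cof i -> fib p -> weq p -> lifts i p;
  tcof_fib_lifts : forall A B X Y (i : pmap A B) (p : pmap X Y),
    cof i -> weq i -> fib p -> lifts i p;
  factor_cof_tfib : forall X Y (f : pmap X Y),
    exists Z (i : pmap X Z) (p : pmap Z Y),
      [/\ f = pcomp p i, cof i, fib p & weq p];
  factor_tcof_fib : forall X Y (f : pmap X Y),
    exists Z (i : pmap X Z) (p : pmap Z Y),
      [/\ f = pcomp p i, cof i, weq i & fib p] }.

Program Definition terminal : presheaf C :=
  {| psh := fun _ => unit; psh_map := fun _ _ _ x => x |}.

Program Definition to_terminal (X : presheaf C) : pmap X terminal :=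
  {| pmap_at := fun _ _ => tt |}.

Definition fibrant (M : model_structure) (X : presheaf C) : Prop :=
  fib M (to_terminal X).

Record fibrant_replacement (M : model_structure) := FibrantReplacement {
  repl :> presheaf C -> presheaf C;
  repl_map : forall X Y, pmap X Y -> pmap (repl X) (repl Y);
  repl_unit : forall X, pmap X (repl X);
  repl_id : forall X, repl_map (pid X) = pid (repl X);
  repl_comp : forall X Y Z (g : pmap Y Z) (f : pmap X Y),
    repl_map (pcomp g f) = pcomp (repl_map g) (repl_map f);
  repl_nat : forall X Y (f : pmap X Y),
    pcomp (repl_map f) (repl_unit X) = pcomp (repl_unit Y) f;
  repl_weq : forall X, weq M (repl_unit X);
  repl_fibrant : forall X, fibrant M (repl X) }.

End Classes.

Definition normal_mono : mclass Omega := fun X Y f =>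
  forall P : mclass Omega,
    (forall T : tree, P _ _ (sieve_incl (boundary T))) ->
    closed_pushout P -> closed_retract P -> closed_transfinite P -> P _ _ f.

(* A model structure is determined by its cofibrations and its fibrant objects,
   so at most one model structure satisfies each of the next two conditions. *)
Definition cisinski_moerdijk (M : model_structure Omega) : Prop :=
  (forall X Y (f : pmap X Y), cof M f <-> normal_mono f) /\
  (forall D : dset, fibrant M D <-> infty_operad D).

Definition stable (M : model_structure Omega) : Prop :=
  (forall X Y (f : pmap X Y), cof M f <-> normal_mono f) /\
  (forall D : dset, fibrant M D <-> fully_kan D).

Definition delta_hom (n m : nat) : SET :=
  {f : 'I_n.+1 -> 'I_m.+1 | forall i j : 'I_n.+1, i <= j -> f i <= f j}.

Program Definition Delta : category :=
  {| ob := nat; hom := delta_hom;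
     idm := fun n => exist _ id _;
     compm := fun n m p g f => exist _ (fun i => sval g (sval f i)) _ |}.
Next Obligation. by move: f g => [f Hf] [g Hg] /=; apply/Hg/Hf. Qed.
Next Obligation. by case: f => f Hf; apply: eq_exist. Qed.
Next Obligation. by case: f => f Hf; apply: eq_exist. Qed.
Next Obligation. by apply: eq_exist. Qed.

Lemma linear_map_vertex (n m : nat) (f : delta_hom n m)
    (v : edge (linear n)) : ~~ leaf v ->
  tree_op (linear m)
    (fun x : {x : edge (linear n) | parent x == Some v} => sval f (val x))
    (sval f v).
Proof.
move=> /TreeOpVertex/linear_op[i0 [iE le_i0]]; apply/linear_op.
by exists i0; split=> //; apply: (svalP f).
Qed.

Lemma tree_hom_eq (S T : tree) (f g : tree_hom S T) : f =1 g -> f = g.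
Proof.
case: f g => [f0 f fP] [g0 g gP] /= /funext fg; subst g0.
have fg : f = g.
  do 4!apply: functional_extensionality_dep => ?.
  by apply: (@Prop_irrelevance (tree_op _ _ _)).
by subst g; apply: operad_hom_eq.
Qed.

(* The inclusion i of the simplex category into Omega. *)
Program Definition delta_omega : functor Delta Omega :=
  {| fob := linear;
     fmap := fun n m f => @tree_hom_of (linear n) (linear m) (sval f)
                              (linear_map_vertex f) |}.
Next Obligation. exact: tree_hom_eq. Qed.
Next Obligation. exact: tree_hom_eq. Qed.

Definition sset := presheaf Delta.

Program Definition coface (n : nat) (i : 'I_n.+2) :
    hom (n : ob Delta) (n.+1 : ob Delta) :=
  exist _ (lift i) _.
Next Obligation. by rewrite /= leq_bump2. Qed.

Program Definition to_point (n : nat) : hom (n : ob Delta) (0 : ob Delta) :=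
  exist _ (fun=> ord0) _.

Section Quotient.
Variables (T : Type) (R : T -> T -> Prop).

(* Quotient by the equivalence relation generated by R; in the intended use R is
   [homotopic] on a Kan complex, which is already an equivalence relation. *)
Inductive equiv_closure : T -> T -> Prop :=
| EquivStep a b : R a b -> equiv_closure a b
| EquivRefl a : equiv_closure a a
| EquivSym a b : equiv_closure a b -> equiv_closure b a
| EquivTrans a b c :
    equiv_closure a b -> equiv_closure b c -> equiv_closure a c.

Definition quotient := {A : T -> Prop | exists a, A = equiv_closure a}.

Definition quot_class (a : T) : quotient :=
  exist _ (equiv_closure a) (ex_intro _ a erefl).

End Quotient.

Lemma quotient_map_proof (T T' : Type) (R : T -> T -> Prop)
    (R' : T' -> T' -> Prop) (f : T -> T')
    (fR : forall a b, R a b -> R' (f a) (f b)) (A : quotient R) :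
  exists b', (fun b => exists2 a, sval A a & equiv_closure R' (f a) b) =
             equiv_closure R' b'.
Proof.
case: A => A AP /=; have [a0 {AP}->] := AP; exists (f a0); apply: funext => b; apply: propext.
have fE a b' : equiv_closure R a b' -> equiv_closure R' (f a) (f b').
  elim=> {a b'} [a b' /fR|a|a b' _|a b' c _ IH1 _ IH2].
  - exact: EquivStep.
  - exact: EquivRefl.
  - exact: EquivSym.
  - exact: EquivTrans IH1 IH2.
split=> [[a /fE aa0]|fb]; first exact: EquivTrans.
by exists a0 => //; exact: EquivRefl.
Qed.

Definition quotient_map (T T' : Type) (R : T -> T -> Prop)
    (R' : T' -> T' -> Prop) (f : T -> T')
    (fR : forall a b, R a b -> R' (f a) (f b)) (A : quotient R) : quotient R' :=
  exist _ _ (quotient_map_proof fR A).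

(* The classical combinatorial definition (May), for a Kan complex X: classes
   of n-simplices whose boundary is constant at the vertex x. *)
Section HomotopyGroups.
Variables (X : sset) (n : nat) (x : X 0).

Definition const_simplex (m : nat) : X m := psh_map (to_point m) x.

Definition is_sphere (a : X n) : Prop :=
  forall (m : nat) (g : hom (m : ob Delta) (n : ob Delta)),
    ~ (forall j, exists i, sval g i = j) -> psh_map g a = const_simplex m.

Definition sphere := {a : X n | is_sphere a}.

Definition homotopic (a b : sphere) : Prop :=
  exists y : X n.+1, forall i : 'I_n.+2,
    psh_map (coface i) y =
    if i == n.+1 :> nat then sval b
    else if i == n :> nat then sval a else const_simplex n.

Definition homotopy_group := quotient homotopic.

(* C is the product of A and B: for n >= 1 this is the graph of the
   group law. *)
Definition homotopy_mul (A B C : homotopy_group) : Prop :=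
  exists (a b c : sphere) (y : X n.+1),
    [/\ quot_class homotopic a = A, quot_class homotopic b = B,
        quot_class homotopic c = C
      & forall i : 'I_n.+2, psh_map (coface i) y =
          if i == n.+1 :> nat then sval b
          else if i == n :> nat then sval c
          else if i == n.-1 :> nat then sval a else const_simplex n].

End HomotopyGroups.

Arguments const_simplex {X} x m.
Arguments is_sphere {X n} x a.
Arguments sphere {X} n x.
Arguments homotopic {X n x} a b.
Arguments homotopy_group {X} n x.

Section HomotopyMap.
Variables (X Y : sset) (f : pmap X Y) (n : nat) (x : X 0).

Lemma const_simplex_map m : f m (const_simplex x m) = const_simplex (f 0 x) m.
Proof. exact: pmap_nat. Qed.

Lemma is_sphere_map (a : X n) : is_sphere x a -> is_sphere (f 0 x) (f n a).
Proof. by move=> aP m g /aP ga; rewrite -pmap_nat ga const_simplex_map. Qed.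

Definition sphere_map (a : sphere n x) : sphere n (f 0 x) :=
  exist _ (f n (sval a)) (is_sphere_map (svalP a)).

Lemma homotopic_map (a b : sphere n x) :
  homotopic a b -> homotopic (sphere_map a) (sphere_map b).
Proof.
move=> [y yP]; exists (f n.+1 y) => i; rewrite -pmap_nat yP.
by do 2!case: ifP => // _; exact: const_simplex_map.
Qed.

Definition homotopy_map : homotopy_group n x -> homotopy_group n (f 0 x) :=
  quotient_map homotopic_map.

End HomotopyMap.

Definition corolla_edge (n : nat) : finType := option 'I_n.

Definition corolla_parent (n : nat) (x : corolla_edge n) :
    option (corolla_edge n) := if x is Some _ then Some None else None.

Definition corolla_leaf (n : nat) : pred (corolla_edge n) := fun x => x != None.

Lemma corolla_leafP n (e x : corolla_edge n) :
  corolla_parent x = Some e -> ~~ corolla_leaf e.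
Proof. by case: x => [i|] //= [<-]. Qed.

Lemma corolla_treeP n : exists2 r, @corolla_parent n r = None &
  forall e, exists m, iter m (obind (@corolla_parent n)) (Some e) = Some r.
Proof. by exists None => // -[i|]; [exists 1 | exists 0]. Qed.

Definition corolla (n : nat) : tree :=
  Tree (@corolla_leafP n) (@corolla_treeP n).

Section KGroups.
Variables (M : model_structure Omega) (R : fibrant_replacement M).

(* The space i^* D_K. *)
Definition Kspace (D : dset) : sset := restr delta_omega (R D).

Definition Kspace_map (D D' : dset) (f : pmap D D') :
  pmap (Kspace D) (Kspace D') := restr_map delta_omega (repl_map R f).

Definition Kgroup (n : nat) (D : dset) (x : Kspace D 0) := homotopy_group n x.

Definition K_map (n : nat) (D D' : dset) (f : pmap D D') (x : Kspace D 0) :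
  Kgroup n x -> Kgroup n (Kspace_map f 0 x) :=
  @homotopy_map _ _ (Kspace_map f) n x.

Lemma vertex_is_sphere (X : sset) (x a : X 0) : is_sphere (n := 0) x a.
Proof. by move=> m g []; move=> j; exists ord0; rewrite !ord1. Qed.

(* The component of a vertex; the base point x plays no role when n = 0. *)
Definition K0_class (D : dset) (x a : Kspace D 0) : Kgroup 0 x :=
  quot_class homotopic (exist _ a (vertex_is_sphere x a)).

Definition at_edge (D : dset) (T : tree) (e : edge T) (p : R D T) :
  Kspace D 0 :=
  psh_map (edge_incl e : hom (linear 0 : ob Omega) (T : ob Omega)) p.

(* The graph of the addition of the infinite loop space i^* D_K on components:
   the root of a binary operation is the sum of its two inputs. *)
Definition K0_add (D : dset) (x : Kspace D 0) (A B C : Kgroup 0 x) : Prop :=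
  exists p : R D (corolla 2),
    [/\ K0_class x (at_edge (T := corolla 2) (Some ord0) p) = A,
        K0_class x (at_edge (T := corolla 2) (Some ord_max) p) = B
      & K0_class x (at_edge (T := corolla 2) None p) = C].

Definition K_op (n : nat) (D : dset) (x : Kspace D 0) :
    Kgroup n x -> Kgroup n x -> Kgroup n x -> Prop :=
  match n with
  | 0 => @K0_add D x
  | m.+1 => @homotopy_mul (Kspace D) m.+1 x
  end.

Definition K_iso (n : nat) (D D' : dset) (x : Kspace D 0) (y : Kspace D' 0)
    (phi : Kgroup n x -> Kgroup n y) : Prop :=
  bijective phi /\
  (forall A B C, K_op A B C <-> K_op (phi A) (phi B) (phi C)).

End KGroups.

(* Main.v *)
From mathcomp Require Import all_boot.
From mathcomp Require Import boolp zify.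
Require Import Defs.

(** Call a map of dendroidal sets a pi-isomorphism if it induces isomorphisms on
the homotopy groups of underlying simplicial sets at all base points, and on
components with the addition read off from binary operations.

The two model structures have the same cofibrations, hence the same trivial
fibrations, namely the maps with the right lifting property against
cofibrations.  This already makes a trivial fibration of the stable structure a
pi-isomorphism: it lifts against the boundaries of linear trees and of
corollas, so that spheres, homotopies, multiplication simplices and binary
operations lift along it, with any prescribed lift of the boundary
([trivial_fibration_pi_iso]).  By Ken Brown's factorization every stable weak
equivalence between stably fibrant objects is then a pi-isomorphism
([weq_fibrant_pi_iso]), in particular R w is one for every stable weak
equivalence w.

An operadic equivalence is a trivial cofibration i : D -> D' followed by a
trivial fibration of the operadic structure, and only i needs an argument.
Stably fibrant objects are fully Kan, hence inner Kan, hence operadically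
fibrant; so the unit D -> R D extends along i to a map g : D' -> R D.  The maps
R i o g and the unit D' -> R D' agree on D, and lifting into an operadic path
object of R D' shows that they are homotopic.  The evaluations of that path
object are trivial fibrations, for either structure, so R i o g is a stable weak
equivalence because the unit is ([weq_of_agree]).  Thus both R g o R i and
R (R i) o R g are pi-isomorphisms, and the two-out-of-six property gives that
R i is one.

To lift along boundaries of linear trees one has to know that a map out of the
boundary of L_m amounts to a compatible family indexed by the non-surjective
monotone maps into [m].  This holds because a tree with a morphism to a linear
tree is itself isomorphic to a linear tree ([linear_iso]). *)

Set Implicit Arguments.
Unset Strict Implicit.
Unset Printing Implicit Defensive.

(** * Presheaves and their products *)

Lemma pmap_eq (C : category) (X Y : presheaf C) (f g : pmap X Y) :
  (forall a (x : X a), f a x = g a x) -> f = g.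
Proof.
case: f g => [f fP] [g gP] /= fg.
have {}fg : f = g.
  by apply: functional_extensionality_dep => a; apply: funext => x; apply: fg.
by subst g; rewrite (Prop_irrelevance fP gP).
Qed.

Lemma pcomp_at (C : category) (X Y Z : presheaf C) (g : pmap Y Z) (f : pmap X Y)
    (h : pmap X Z) : pcomp g f = h -> forall a (x : X a), g a (f a x) = h a x.
Proof. by move=> <-. Qed.

Lemma pcomp_sq (C : category) (A B X Y : presheaf C) (p : pmap X Y)
    (u : pmap A X) (v : pmap B Y) (i : pmap A B) :
  pcomp p u = pcomp v i -> forall a (x : A a), p a (u a x) = v a (i a x).
Proof. by move=> e a x; apply: pcomp_at e a x. Qed.

Section Products.
Variable C : category.

Program Definition product (X Y : presheaf C) : presheaf C :=
  {| psh := fun a => (X a * Y a)%type;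
     psh_map := fun _ _ f z => (psh_map f z.1, psh_map f z.2) |}.
Next Obligation. by rewrite !psh_id. Qed.
Next Obligation. by rewrite !psh_comp. Qed.

Program Definition proj1 (X Y : presheaf C) : pmap (product X Y) X :=
  {| pmap_at := fun _ z => z.1 |}.

Program Definition proj2 (X Y : presheaf C) : pmap (product X Y) Y :=
  {| pmap_at := fun _ z => z.2 |}.

Program Definition pairing (A X Y : presheaf C) (f : pmap A X) (g : pmap A Y) :
    pmap A (product X Y) := {| pmap_at := fun a z => (f a z, g a z) |}.
Next Obligation. by rewrite !pmap_nat. Qed.

End Products.

(** * Trivial fibrations and lifting in a model structure *)

Section ModelStructures.
Variables (C : category) (M : model_structure C).

(** The retract argument, from which both lifting characterizations below
follow. *)
Lemma retract_of_factor (X Y Z : presheaf C) (f : pmap X Y) (i : pmap X Z)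
    (p : pmap Z Y) : f = pcomp p i -> lifts i f -> is_retract f p.
Proof.
move=> fE /(_ (pid X) p)[|h [hi fh]]; first by rewrite -fE; apply: pmap_eq.
exists i, h, (pid Y), (pid Y); split=> //; apply: pmap_eq => a x //=.
  by rewrite fE.
by rewrite -[in RHS]fh.
Qed.

Lemma fib_of_lifts (X Y : presheaf C) (f : pmap X Y) :
  (forall A B (i : pmap A B), cof M i -> weq M i -> lifts i f) -> fib M f.
Proof.
move=> fL; have [Z [i [p [fE ic iw pf]]]] := factor_tcof_fib M f.
exact: fib_retract (retract_of_factor fE (fL _ _ _ ic iw)) pf.
Qed.

Definition tfib (X Y : presheaf C) (f : pmap X Y) := fib M f /\ weq M f.

Lemma tfib_of_lifts (X Y : presheaf C) (f : pmap X Y) :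
  (forall A B (i : pmap A B), cof M i -> lifts i f) -> tfib f.
Proof.
move=> fL; have [Z [i [p [fE ic pf pw]]]] := factor_cof_tfib M f.
have fp := retract_of_factor fE (fL _ _ _ ic).
by split; [apply: fib_retract fp pf | apply: weq_retract fp pw].
Qed.

Lemma tfib_pid (X : presheaf C) : tfib (pid X).
Proof.
apply: tfib_of_lifts => A B i _ u v uv; exists v; split.
  by rewrite -uv; apply: pmap_eq.
exact: pmap_eq.
Qed.

Lemma lifts_comp (A B X Y Z : presheaf C) (i : pmap A B) (p : pmap X Y)
    (q : pmap Y Z) : lifts i p -> lifts i q -> lifts i (pcomp q p).
Proof.
move=> ip iq u v uv.
have [|h [hi qh]] := iq (pcomp p u) v; first by rewrite -uv; apply: pmap_eq.
have [k [ki pk]] := ip u h (esym hi).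
by exists k; split=> //; rewrite -qh -pk; apply: pmap_eq.
Qed.

Lemma fib_comp (X Y Z : presheaf C) (p : pmap X Y) (q : pmap Y Z) :
  fib M p -> fib M q -> fib M (pcomp q p).
Proof.
move=> pf qf; apply: fib_of_lifts => A B i ic iw.
by apply: lifts_comp; apply: (tcof_fib_lifts (m := M)).
Qed.

Lemma fibrant_extend (A B X : presheaf C) (i : pmap A B) (u : pmap A X) :
  fibrant M X -> cof M i -> weq M i -> exists h : pmap B X, pcomp h i = u.
Proof.
move=> Xf ic iw.
have [|h [hi _]] := tcof_fib_lifts ic iw Xf (u := u) (v := to_terminal B).
  exact: pmap_eq.
by exists h.
Qed.

Lemma fib_proj1 (X Y : presheaf C) : fibrant M Y -> fib M (@proj1 C X Y).
Proof.
move=> Yf; apply: fib_of_lifts => A B i ic iw u v uv.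
have [h hi] := fibrant_extend (pcomp (@proj2 C X Y) u) Yf ic iw.
exists (pairing v h); split; apply: pmap_eq => a x //=.
by rewrite -(pcomp_sq uv) (pcomp_at hi) /=; case: (u a x).
Qed.

Lemma fib_proj2 (X Y : presheaf C) : fibrant M X -> fib M (@proj2 C X Y).
Proof.
move=> Xf; apply: fib_of_lifts => A B i ic iw u v uv.
have [h hi] := fibrant_extend (pcomp (@proj1 C X Y) u) Xf ic iw.
exists (pairing h v); split; apply: pmap_eq => a x //=.
by rewrite -(pcomp_sq uv) (pcomp_at hi) /=; case: (u a x).
Qed.

(** Ken Brown's factorization: j comes from the graph of w, and both projections
of the resulting fibration Z -> X x Y are trivial fibrations.  A property of
maps that holds for trivial fibrations and satisfies two-out-of-three therefore
holds for w. *)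
Lemma weq_fibrant_factor (X Y : presheaf C) (w : pmap X Y) :
  fibrant M X -> fibrant M Y -> weq M w ->
  exists Z (j : pmap X Z) (s : pmap Z X) (p : pmap Z Y),
    [/\ tfib s, tfib p, pcomp s j = pid X & pcomp p j = w].
Proof.
move=> Xf Yf ww.
have [Z [j [q [qj jc jw qf]]]] := factor_tcof_fib M (pairing (pid X) w).
have sj : pcomp (pcomp (proj1 X Y) q) j = pid X.
  by apply: pmap_eq => a x /=; rewrite (pcomp_at (esym qj)).
have pj : pcomp (pcomp (proj2 X Y) q) j = w.
  by apply: pmap_eq => a x /=; rewrite (pcomp_at (esym qj)).
exists Z, j, (pcomp (proj1 X Y) q), (pcomp (proj2 X Y) q); split=> //; split.
- exact: fib_comp qf (fib_proj1 _ Yf).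
- by apply: weq_cancell jw _; rewrite sj; case: (tfib_pid X).
- exact: fib_comp qf (fib_proj2 _ Xf).
- by apply: weq_cancell jw _; rewrite pj.
Qed.

End ModelStructures.

(** * Two model structures with the same cofibrations *)

Section Localization.
Variables (C : category) (M N : model_structure C).
Hypothesis cofMN : forall X Y (f : pmap X Y), cof M f <-> cof N f.

Lemma tfib_transfer (X Y : presheaf C) (f : pmap X Y) : tfib M f -> tfib N f.
Proof.
move=> [ff fw]; apply: tfib_of_lifts => A B i /cofMN ic.
exact: cof_tfib_lifts ic ff fw.
Qed.

(** Two extensions g and h of one map along a trivial cofibration of M are
homotopic in M, through a path object P of X.  Both evaluations P -> X are
trivial fibrations, a notion common to M and N, so the homotopy is also seen by
the weak equivalences of N. *)
Lemma weq_of_agree (A B X : presheaf C) (i : pmap A B) (g h : pmap B X) :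
  fibrant M X -> cof M i -> weq M i -> pcomp g i = pcomp h i ->
  weq N h -> weq N g.
Proof.
move=> Xf ic iw ghi hw.
have [P [c [q [qc cc cw qf]]]] := factor_tcof_fib M (pairing (pid X) (pid X)).
have ev0 : tfib N (pcomp (proj1 X X) q).
  apply: tfib_transfer; split; first exact: fib_comp qf (fib_proj1 _ Xf).
  apply: weq_cancell cw _.
  have -> : pcomp (pcomp (proj1 X X) q) c = pid X.
    by apply: pmap_eq => a x /=; rewrite (pcomp_at (esym qc)).
  by case: (tfib_pid M X).
have ev1 : tfib N (pcomp (proj2 X X) q).
  apply: tfib_transfer; split; first exact: fib_comp qf (fib_proj2 _ Xf).
  apply: weq_cancell cw _.
  have -> : pcomp (pcomp (proj2 X X) q) c = pid X.
    by apply: pmap_eq => a x /=; rewrite (pcomp_at (esym qc)).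
  by case: (tfib_pid M X).
(* The homotopy H from g to h is constant on A. *)
have [|H [_ qH]] := tcof_fib_lifts ic iw qf (u := pcomp c (pcomp h i))
                     (v := pairing g h).
  by apply: pmap_eq => a x /=; rewrite (pcomp_at (esym qc)) /= (pcomp_sq ghi).
have -> : g = pcomp (pcomp (proj1 X X) q) H.
  by apply: pmap_eq => a x /=; rewrite (pcomp_at qH).
apply: weq_comp ev0.2; apply: weq_cancelr ev1.2 _.
have -> // : pcomp (pcomp (proj2 X X) q) H = h.
by apply: pmap_eq => a x /=; rewrite (pcomp_at qH).
Qed.

End Localization.

(** * Trees over a linear tree *)

Section Depth.
Variable S : tree.
Implicit Types x y : edge S.

Lemma ancestors_end x :
  exists d, iter d (obind (@parent S)) (Some x) == None.
Proof.
have [r r0 /(_ x)[d dE]] := treeP S.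
by exists d.+1; rewrite iterS dE /= r0.
Qed.

(** Iterating the parent map on x reaches None one step after the root. *)
Definition depth x := (ex_minn (ancestors_end x)).-1.

Lemma depth_root x : parent x = None -> depth x = 0.
Proof.
move=> x0; rewrite /depth; case: ex_minnP => d _ /(_ 1) /=.
by rewrite x0 eqxx => /(_ isT); case: d => // [] [].
Qed.

Lemma depth_parent x y : parent x = Some y -> depth x = (depth y).+1.
Proof.
move=> xy; rewrite /depth.
case: ex_minnP => -[|d] // dP dmin; case: ex_minnP => -[|c] // cP cmin.
rewrite iterSr /= xy in dP.
by apply/eqP; rewrite /= eqn_leq cmin // -ltnS dmin // iterSr /= xy.
Qed.

End Depth.

Section Unary.
Variables (m : nat) (S : tree) (g : tree_hom S (linear m)).
Implicit Types x y e v : edge S.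

(** The morphism g sends the vertex v to an operation of a linear tree, which
has exactly one input. *)
Lemma unary_child v : ~~ leaf v ->
  exists2 x, parent x = Some v & forall y, parent y = Some v -> y = x.
Proof.
move=> /TreeOpVertex op_v.
have /linear_op[[x xv] [xE _]] := @hop _ _ g _ _ _ op_v.
exists x => [|y /eqP yv]; first exact/eqP.
exact: (congr1 val (xE (exist _ y yv))).
Qed.

Lemma unary_parent_inj x y v : parent x = Some v -> parent y = Some v -> x = y.
Proof.
move=> xv yv; have [z _ zE] := unary_child (leafP xv).
by rewrite (zE _ xv) (zE _ yv).
Qed.

Lemma depth_inj : injective (@depth S).
Proof.
move=> x y; elim/parent_ind: x y => x IH y.
case xx: (parent x) => [x'|]; case yy: (parent y) => [y'|];
  rewrite ?(depth_parent xx) ?(depth_parent yy) ?(depth_root xx) ?(depth_root yy) //.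
- move=> [/(IH _ xx) x'y']; subst y'; exact: unary_parent_inj xx yy.
- by move=> _; apply: root_unique.
Qed.

Definition length := \max_(x : edge S) depth x.

Lemma depth_le x : depth x <= length.
Proof. exact: leq_bigmax. Qed.

Lemma depth_surj d : d <= length -> exists x, depth x == d.
Proof.
have [r r0 _] := treeP S.
have [x xE] : exists x, length = depth x.
  have [|y yE] := @eq_bigmax _ (@depth S); last by exists y.
  by apply/card_gt0P; exists r.
rewrite xE; elim/parent_ind: x {xE} => x IH.
case xy: (parent x) => [y|]; last first.
  by rewrite (depth_root xy) leqn0 => /eqP ->; exists x; rewrite depth_root.
rewrite leq_eqVlt (depth_parent xy) ltnS => /orP[/eqP ->|/(IH _ xy)//].
by exists x; rewrite (depth_parent xy).
Qed.

(** In a linear tree the leaf is the edge 0 and the root is the last edge, hence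
the reversal of depths. *)
Definition to_line_fun x : 'I_length.+1 := inord (length - depth x).

Lemma to_line_funE x : to_line_fun x = length - depth x :> nat.
Proof. by rewrite inordK // ltnS leq_subr. Qed.

Lemma of_line_ex (i : 'I_length.+1) : exists x, depth x == length - i.
Proof. by apply: depth_surj; apply: leq_subr. Qed.

Definition of_line_fun (i : 'I_length.+1) := xchoose (of_line_ex i).

Lemma of_line_funE i : depth (of_line_fun i) = length - i.
Proof. by apply/eqP; apply: (xchooseP (of_line_ex i)). Qed.

Lemma of_lineK : cancel of_line_fun to_line_fun.
Proof.
move=> i; apply/val_inj; rewrite /= to_line_funE of_line_funE subKn //.
by rewrite -ltnS.
Qed.

Lemma to_lineK : cancel to_line_fun of_line_fun.
Proof.
by move=> x; apply: depth_inj; rewrite of_line_funE to_line_funE subKn ?depth_le.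
Qed.

Lemma parent_of_line (i j : 'I_length.+1) :
  i.+1 = j -> parent (of_line_fun i) = Some (of_line_fun j).
Proof.
move=> ij; have jl : j <= length by rewrite -ltnS.
have il : i < length by rewrite ij.
case ip: (parent (of_line_fun i)) => [y|]; last first.
  have := of_line_funE i; rewrite (depth_root ip) => /esym/eqP.
  by rewrite subn_eq0 leqNgt il.
congr Some; apply: depth_inj; apply/succn_inj.
by rewrite -(depth_parent ip) !of_line_funE -ij subnSK.
Qed.

Lemma of_line_vertex (v : edge (linear length)) : ~~ leaf v ->
  tree_op S (fun x : {x : edge (linear length) | parent x == Some v} =>
               of_line_fun (val x)) (of_line_fun v).
Proof.
move=> /TreeOpVertex/linear_op[[i0 iv] [iE _]].
have i0v : i0.+1 = v by apply/eqP; rewrite -linear_parentE.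
have pv := parent_of_line i0v.
have nl := leafP pv.
apply: (@tree_op_reindex S _ _
  (fun=> exist (fun x : edge S => parent x == Some (of_line_fun v)) _
           (introT eqP pv)) _ _ _ _ _ _ (TreeOpVertex nl)).
- by move=> i j _; rewrite (iE i) (iE j).
- move=> [y yv]; exists (exist _ i0 iv); apply/val_inj => /=.
  exact: unary_parent_inj pv (eqP yv).
- by move=> j; rewrite (iE j).
Qed.

Lemma to_line_vertex v : ~~ leaf v ->
  tree_op (linear length) (fun x : {x | parent x == Some v} =>
    to_line_fun (val x)) (to_line_fun v).
Proof.
move=> /unary_child[x xv xE]; apply/linear_op.
exists (exist _ x (introT eqP xv)); split=> [[y yv]|/=].
  by apply/val_inj/xE/eqP.
by rewrite !to_line_funE (depth_parent xv) leq_sub2l.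
Qed.

Definition of_line : tree_hom (linear length) S := tree_hom_of of_line_vertex.
Definition to_line : tree_hom S (linear length) := tree_hom_of to_line_vertex.

End Unary.

Lemma linear_hom_mono (n m : nat) (g : tree_hom (linear n) (linear m))
    (i j : 'I_n.+1) : i <= j -> (g i : 'I_m.+1) <= (g j : 'I_m.+1).
Proof.
move=> ij.
have /(@hop _ _ g)/linear_op[_ [_ //]] :
  tree_op (linear n) (fun _ : unit => i) j.
by apply/linear_op; exists tt; split=> // -[].
Qed.

Lemma linear_iso (m : nat) (S : tree) (g : tree_hom S (linear m)) :
  exists (k : nat) (a : tree_hom (linear k) S) (b : tree_hom S (linear k)),
    cancel a b /\ cancel b a.
Proof.
exists (length S), (of_line g), (to_line g).
by split; [apply: of_lineK | apply: to_lineK g].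
Qed.

(** Factorization through f only depends on images: f is injective on edges, and
after identifying S with a linear tree, it reflects the order of edges. *)
Lemma linear_factor (m n : nat) (S : tree) (f : tree_hom S (linear m))
    (g : tree_hom (linear n) (linear m)) :
  injective f -> (forall i, exists x, f x = g i) ->
  exists h : tree_hom (linear n) S, forall i, f (h i) = g i.
Proof.
move=> f_inj fg; have [k [a [b [ab ba]]]] := linear_iso f.
have fgb i : exists x, f x == g i by have [x <-] := fg i; exists x.
pose h i := xchoose (fgb i).
have fh i : f (h i) = g i by apply/eqP; apply: (xchooseP (fgb i)).
have bh_mono (i j : 'I_n.+1) : i <= j ->
    (b (h i) : 'I_k.+1) <= (b (h j) : 'I_k.+1).
  move=> ij; rewrite leqNgt; apply/negP => ji.
  have := linear_hom_mono (operad_compm f a) (ltnW ji); rewrite /= !ba !fh => gji.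
  have ghij : h i = h j.
    apply: f_inj; rewrite !fh; apply/val_inj/eqP => /=.
    by rewrite eqn_leq gji linear_hom_mono.
  by rewrite ghij ltnn in ji.
have hv (v : edge (linear n)) : ~~ leaf v ->
  tree_op (linear k) (fun x : {x : edge (linear n) | parent x == Some v} =>
    b (h (val x))) (b (h v)).
  move=> /TreeOpVertex/linear_op[i0 [iE le_i0]]; apply/linear_op.
  by exists i0; split=> //; apply: bh_mono.
pose bh := tree_hom_of (f := fun i : edge (linear n) => b (h i)) hv.
exists (operad_compm a bh) => i /=.
by rewrite ba fh.
Qed.

(** * Boundaries of linear trees *)

Lemma face_map_inj (T : tree) (a : face T) : injective (face_map a).
Proof.
case: a => [e ei|v vo|e e1] x y /=; [exact: val_inj | exact: val_inj |].
by rewrite (ord1 x) (ord1 y).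
Qed.

Lemma linear_innerE m (i : edge (linear m)) : inner i = (0 < (i : nat) < m).
Proof.
rewrite /inner /= /linear_leaf -lt0n; congr andb.
rewrite /linear_parent; case: insubP => [k kP _|]; last by rewrite ltnS; case: ltnP.
by rewrite -ltnS kP.
Qed.

Lemma linear_attachedE m (i v : edge (linear m)) :
  attached i v = (i == v) || (i.+1 == v :> nat).
Proof. by rewrite /attached [parent i == _]linear_parentE. Qed.

Lemma face_linear_misses m (a : face (linear m)) :
  exists j : edge (linear m), forall x, face_map a x != j.
Proof.
case: a => [e ei|v vo|e e1] /=.
- by exists e => x; exact: (valP x).
(* Chopping off the vertex v removes the edge v unless that edge is inner.  If it
   is, it is the only inner edge attached to the vertex, and the input is
   removed. *)
- have [vi|vi] := boolP (inner v).
    have v0 : 0 < (v : nat) by move: vi; rewrite linear_innerE => /andP[].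
    have cm : (v : nat).-1 < m.+1 by rewrite (leq_ltn_trans (leq_pred _)).
    have cv : attached (Ordinal cm : edge (linear m)) v.
      by rewrite linear_attachedE /= prednK // eqxx orbT.
    exists (Ordinal cm) => x; apply/eqP => xc; move: (valP x).
    rewrite [val x]xc /= /chop_keep cv /= negbK => ci.
    have vv : attached v v by rewrite /attached eqxx.
    have /(congr1 val)/= := chop_unique vo cv ci vv vi.
    by move/eqP; rewrite -{2}(prednK v0) ltn_eqF.
  exists v => x; apply/eqP => xv; move: (valP x).
  by rewrite /= [val x]xv /chop_keep /attached eqxx vi.
- have e0 : exists j : edge (linear m), e != j.
    move: e1; rewrite /vertices; case: m e => [|m] e e1.
      by rewrite eq_card0 // in e1 => i; rewrite inE /= /linear_leaf ord1.
    have [->|e0] := eqVneq e ord0; last by exists ord0.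
    by exists ord_max.
  by have [j ej] := e0; exists j.
Qed.

Lemma boundary_linear_misses m (S : tree) (g : tree_hom S (linear m)) :
  in_sieve (boundary (linear m)) (g : hom (S : ob Omega) (linear m : ob Omega)) ->
  exists j : edge (linear m), forall x, g x != j.
Proof.
move=> [a _ [h ->]]; have [j aj] := face_linear_misses a.
by exists j => x; apply: aj.
Qed.

Lemma linear_vertices m : vertices (linear m) = m.
Proof.
rewrite /vertices (eq_card (B := predC1 ord0)); last first.
  by move=> i; rewrite !inE /= /linear_leaf.
by rewrite cardC1 card_ord.
Qed.

(** The face opposite to j chops off the leaf vertex or the root vertex if j is
extremal, and contracts j otherwise; for m = 1 it is the other edge. *)
Lemma face_of_missing m (j : edge (linear m)) : 0 < m ->
  exists a : face (linear m), forall i, i != j -> exists x, face_map a x = i.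
Proof.
move=> m0; case: (ltngtP m 1) => [|m1|m1]; first by rewrite ltnNge m0.
  have jm := ltn_ord j.
  (* It suffices that j is the only outer edge attached to an outer vertex v. *)
  have outer_face (v : edge (linear m)) : outer v ->
      (forall i : edge (linear m), attached i v -> ~~ inner i -> i = j) ->
      exists a : face (linear m), forall i, i != j -> exists x, face_map a x = i.
    move=> vo vj; exists (OuterFace vo) => i ij.
    have ki : chop_keep v i by apply: contra ij => /andP[iv ii]; apply/eqP/vj.
    by exists (exist _ i ki).
  have [j0|j0] := eqVneq (j : nat) 0.
    have v1 : 1 < m.+1 by [].
    apply: (outer_face (Ordinal v1)).
      rewrite /outer /= /linear_leaf /=; apply/eqP/(@eq_card1 _ (Ordinal v1)) => i.
      rewrite !inE linear_attachedE linear_innerE -!val_eqE /=.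
      by lia.
    move=> i; rewrite linear_attachedE linear_innerE -!val_eqE /= => iv ii.
    by apply/val_inj => /=; lia.
  have [jmax|jmax] := eqVneq (j : nat) m.
    have nm : m.-1 < m.+1 by rewrite (leq_ltn_trans (leq_pred _)).
    apply: (outer_face j).
      rewrite /outer /= /linear_leaf j0 /=; apply/eqP/(@eq_card1 _ (Ordinal nm)) => i.
      rewrite !inE linear_attachedE linear_innerE -!val_eqE /= jmax.
      by have := ltn_ord i; lia.
    move=> i; rewrite linear_attachedE linear_innerE -!val_eqE /= => iv ii.
    by apply/val_inj => /=; have := ltn_ord i; lia.
  have ji : inner j.
    by rewrite linear_innerE lt0n j0 ltn_neqAle jmax -ltnS jm.
  by exists (InnerFace ji) => i ij; exists (exist _ i ij).
have v1 : vertices (linear m) == 1 by rewrite linear_vertices m1.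
have [e ej] : exists e : edge (linear m), e != j.
  have [->|] := eqVneq j ord0; last by exists ord0; rewrite eq_sym.
  by exists ord_max; rewrite -val_eqE /= m1.
exists (CorollaFace e v1) => i ij; exists ord0 => /=.
apply/val_inj; move: ij ej; rewrite -!val_eqE /= => ij ej.
by have := ltn_ord i; have := ltn_ord j; have := ltn_ord e; lia.
Qed.

(** Together with [boundary_linear_misses]: among maps of linear trees, the
boundary consists of those that are not surjective on edges. *)
Lemma boundary_linear m k (g : tree_hom (linear k) (linear m))
    (j : edge (linear m)) : (forall x, g x != j) ->
  in_sieve (boundary (linear m)) (g : hom (linear k : ob Omega) (linear m : ob Omega)).
Proof.
move=> gj; have m0 : 0 < m.
  rewrite lt0n; apply: contraNneq (gj ord0) => m0; subst m.
  by rewrite (ord1 j) (ord1 (g ord0)).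
have [a aE] := face_of_missing j m0; exists a => //.
have [|h hE] := linear_factor (f := face_map a) (g := g) (@face_map_inj _ a).
  by move=> i; apply: aE.
by exists h; apply: tree_hom_eq => i; rewrite /= hE.
Qed.

(** Fullness of the inclusion of the simplex category in trees. *)
Definition delta_of n m (g : tree_hom (linear n) (linear m)) :
    hom (n : ob Delta) (m : ob Delta) :=
  exist (fun f : 'I_n.+1 -> 'I_m.+1 => forall i j : 'I_n.+1, i <= j -> f i <= f j)
    (hcol g) (@linear_hom_mono n m g).

Lemma delta_ofK n m (g : tree_hom (linear n) (linear m)) :
  fmap delta_omega (delta_of g) = g.
Proof. exact: tree_hom_eq. Qed.

Lemma delta_hom_eq n m (f g : hom (n : ob Delta) (m : ob Delta)) :
  (forall i, sval f i = sval g i) -> f = g.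
Proof. by case: f g => [f fP] [g gP] /= /funext; apply: eq_exist. Qed.

Definition non_surjective n m (g : hom (n : ob Delta) (m : ob Delta)) : Prop :=
  ~ forall j, exists i, sval g i = j.

Lemma misses_not_surj n m (g : hom (n : ob Delta) (m : ob Delta)) :
  non_surjective g <-> exists j, forall i, sval g i != j.
Proof.
split=> [gns|[j gj] gs]; last first.
  by have [i ij] := gs j; move: (gj i); rewrite ij eqxx.
apply: contrapT => H; apply: gns => j; apply: contrapT => jg; apply: H.
by exists j => i; apply/eqP => ij; apply: jg; exists i.
Qed.

(** Elements over S are detected on linear trees, as S is isomorphic to one. *)
Lemma linear_separated (X : dset) m (S : tree) (g : tree_hom S (linear m))
    (z z' : X S) :
  (forall l (h : hom (linear l : ob Omega) (S : ob Omega)),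
     psh_map h z = psh_map h z') -> z = z'.
Proof.
have [k [a [b [ab ba]]]] := linear_iso g => /(_ k a).
move=> /(congr1 (psh_map (b : hom (S : ob Omega) (linear k : ob Omega)))).
rewrite -!psh_comp.
have -> : compm (a : hom (linear k : ob Omega) S) (b : hom (S : ob Omega) _) =
    idm (S : ob Omega) by exact: tree_hom_eq.
by rewrite !psh_id.
Qed.

Section BoundaryMap.
Variables (X : dset) (m : nat).
Variable u : forall k, hom (k : ob Delta) (m : ob Delta) -> restr delta_omega X k.
Hypothesis u_nat : forall k l (g : hom (k : ob Delta) (m : ob Delta))
    (h : hom (l : ob Delta) (k : ob Delta)), non_surjective g ->
  u (compm g h) = psh_map h (u g).

(** The value at g : S -> L_m of the extension of u to all trees.  Stating it as
a property tested on all linear trees over S makes the value independent of the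
choice of an isomorphism between S and a linear tree, and hence natural. *)
Definition boundary_value (S : tree) (g : tree_hom S (linear m)) (z : X S) :=
  forall l (h : tree_hom (linear l) S),
    psh_map (h : hom (linear l : ob Omega) S) z = u (delta_of (operad_compm g h)).

Lemma boundary_value_unique S (g : tree_hom S (linear m)) z z' :
  boundary_value g z -> boundary_value g z' -> z = z'.
Proof.
by move=> gz gz'; apply: (linear_separated g) => l h; rewrite (gz l h) (gz' l h).
Qed.

Lemma boundary_value_ex S (g : tree_hom S (linear m)) :
  in_sieve (boundary (linear m)) (g : hom (S : ob Omega) (linear m : ob Omega)) ->
  exists z, boundary_value g z.
Proof.
move=> /boundary_linear_misses[j gj]; have [k [a [b [ab ba]]]] := linear_iso g.
exists (psh_map (b : hom (S : ob Omega) (linear k : ob Omega))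
          (u (delta_of (operad_compm g a)))) => l h.
rewrite -psh_comp -[compm _ _]delta_ofK -[LHS]u_nat; last first.
  by apply/misses_not_surj; exists j => i; apply: gj.
by congr u; apply: delta_hom_eq => i /=; rewrite ba.
Qed.

(** A compatible family on the non-surjective monotone maps into [m] is a map out
of the boundary of L_m. *)
Lemma boundary_pmap_ex :
  exists w : pmap (sieve_psh (boundary (linear m))) X,
  forall k (g : hom (k : ob Delta) (m : ob Delta))
    (H : in_sieve (boundary (linear m)) (fmap delta_omega g)),
    w _ (exist _ (fmap delta_omega g) H) = u g.
Proof.
pose w (S : tree) (g : sieve_psh (boundary (linear m)) S) : X S :=
  sval (cid (boundary_value_ex (svalP g))).
have wP S g : boundary_value (sval g) (w S g) by apply: (svalP (cid _)).
have w_nat (S S' : ob Omega) (f : hom S S') g :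
    w S (psh_map f g) = psh_map f (w S' g).
  apply: boundary_value_unique (wP _ _) _ => l h.
  by rewrite -psh_comp wP; congr u; apply: delta_hom_eq.
exists (PMap w_nat) => k g H /=.
have := wP _ (exist _ (fmap delta_omega g) H) k (idm (linear k : ob Omega)).
by rewrite psh_id => ->; congr u; apply: delta_hom_eq.
Qed.

End BoundaryMap.

(** * Homotopy classes of spheres *)

Lemma equiv_closure_eq (T : Type) (R : T -> T -> Prop) a b :
  equiv_closure R a b ->
  equiv_closure R a = equiv_closure R b.
Proof.
move=> ab; apply: funext => c; apply: propext; split.
  exact: EquivTrans (EquivSym ab).
exact: EquivTrans ab.
Qed.

Section Quotients.
Variables (T : Type) (R : T -> T -> Prop).

Lemma quot_class_eq a b :
  quot_class R a = quot_class R b <-> equiv_closure R a b.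
Proof.
split=> [[->]|ab]; first exact: EquivRefl.
exact/eq_exist/equiv_closure_eq.
Qed.

Lemma quot_class_surj A : exists a, quot_class R a = A.
Proof. by case: A => A AP; have [a aE] := AP; exists a; apply: eq_exist. Qed.

Lemma quotient_map_class (T' : Type) (R' : T' -> T' -> Prop) (f : T -> T')
    (fR : forall a b, R a b -> R' (f a) (f b)) a :
  quotient_map fR (quot_class R a) = quot_class R' (f a).
Proof.
have [b bE] := quotient_map_proof fR (quot_class R a).
apply: eq_exist; rewrite bE; apply: equiv_closure_eq; rewrite -bE.
by exists a => //; exact: EquivRefl.
Qed.

End Quotients.

Section Spheres.
Variables (X : sset) (n : nat) (x : X 0).

Lemma sphere_eq (a b : sphere n x) : sval a = sval b -> a = b.
Proof. by case: a b => [a aP] [b bP]; apply: eq_exist. Qed.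

Lemma psh_map_const k l (h : hom (l : ob Delta) (k : ob Delta)) :
  psh_map h (const_simplex x k) = const_simplex x l.
Proof. by rewrite -psh_comp; congr psh_map; apply: delta_hom_eq. Qed.

Lemma const_is_sphere : is_sphere x (const_simplex x n).
Proof. by move=> m g _; apply: psh_map_const. Qed.

Definition const_sphere : sphere n x := exist _ _ const_is_sphere.

Program Definition codegeneracy : hom (n.+1 : ob Delta) (n : ob Delta) :=
  exist _ (fun i => inord (minn i n)) _.
Next Obligation. by rewrite !inordK; lia. Qed.

(** The homotopy is the last degeneracy of a. *)
Lemma homotopic_refl (a : sphere n x) : homotopic a a.
Proof.
exists (psh_map codegeneracy (sval a)) => i; rewrite -psh_comp.
have [ni|ni] := leqP n i.
  have -> : compm codegeneracy (coface i) = idm (n : ob Delta).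
    apply: delta_hom_eq => j; apply/val_inj; rewrite /= inordK /bump;
      have := ltn_ord j; lia.
  by rewrite psh_id; have := ltn_ord i; do 2!case: eqP => //; lia.
rewrite !ltn_eqF //; last by lia.
apply: (svalP a); apply/misses_not_surj; exists (inord i) => j.
rewrite -val_eqE /= !inordK /bump; lia.
Qed.

End Spheres.

(** * Lifting along a trivial fibration *)

Program Definition yoneda_map (C : category) (X : presheaf C) (a : ob C) (x : X a) :
    pmap (yoneda a) X := {| pmap_at := fun b (g : hom b a) => psh_map g x |}.
Next Obligation. exact: psh_comp. Qed.

Section TrivialFibration.
Variables (X Y : dset) (p : pmap X Y).
Hypothesis p_lifts : forall T : tree, lifts (sieve_incl (boundary T)) p.

Notation ip := (restr_map delta_omega p).

Lemma cell_lift (T : tree) (y : Y T) (u : pmap (sieve_psh (boundary T)) X) :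
  (forall S (g : sieve_psh (boundary T) S), p _ (u _ g) = psh_map (sval g) y) ->
  exists2 x : X T, p _ x = y &
    forall S (g : sieve_psh (boundary T) S), psh_map (sval g) x = u _ g.
Proof.
move=> uy; have [|h [hu ph]] := p_lifts (u := u) (v := yoneda_map y).
  by apply: pmap_eq => S g; apply: uy.
exists (h _ (idm (T : ob Omega))); first by rewrite (pcomp_at ph) /= psh_id.
move=> S g; rewrite -(pcomp_at hu) -pmap_nat; congr (h _ _).
exact: (@comp1m Omega).
Qed.

Lemma simplex_lift m (y : restr delta_omega Y m)
    (u : forall k, hom (k : ob Delta) (m : ob Delta) -> restr delta_omega X k) :
  (forall k l (g : hom (k : ob Delta) (m : ob Delta))
      (h : hom (l : ob Delta) (k : ob Delta)), non_surjective g ->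
    u l (compm g h) = psh_map h (u k g)) ->
  (forall k (g : hom (k : ob Delta) (m : ob Delta)), non_surjective g ->
    ip k (u k g) = psh_map g y) ->
  exists2 x : restr delta_omega X m, ip m x = y &
    forall k (g : hom (k : ob Delta) (m : ob Delta)), non_surjective g ->
      psh_map g x = u k g.
Proof.
move=> u_nat pu.
have [w wE] := boundary_pmap_ex u_nat.
have mem k (g : hom (k : ob Delta) (m : ob Delta)) : non_surjective g ->
    in_sieve (boundary (linear m)) (fmap delta_omega g).
  by move=> /misses_not_surj[j gj]; apply: (boundary_linear (j := j)).
have [S g|x px xu] := cell_lift (y := y) (u := w).
  apply: (linear_separated (sval g)) => l k.
  pose gk := delta_of (operad_compm (sval g) k).
  have gk_in : in_sieve (boundary (linear m)) (fmap delta_omega gk).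
    by rewrite delta_ofK; exact: (svalP (psh_map k g)).
  have gk_deg : non_surjective gk.
    apply/misses_not_surj; have [j jP] := boundary_linear_misses gk_in.
    by exists j.
  (* Over linear trees, w is given by u. *)
  have -> : psh_map k (p S (w S g)) = ip l (u l gk).
    rewrite -!pmap_nat -(wE _ _ gk_in); congr (p _ (w _ _)).
    by apply: eq_exist; rewrite delta_ofK.
  rewrite (pu _ _ gk_deg) -[LHS]/(psh_map (fmap delta_omega gk) y) delta_ofK.
  exact: psh_comp.
by exists x => // k g /mem g_in; rewrite -(wE _ _ g_in) -xu.
Qed.

(** The boundary of the tree without vertices is empty. *)
Lemma vertex_lift (y : Y (linear 0)) : exists x, p _ x = y.
Proof.
have no_face S (g : sieve_psh (boundary (linear 0)) S) : False.
  have [j /(_ _)/eqP gj] := boundary_linear_misses (svalP g).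
  have [r _ _] := treeP S; apply: (gj r).
  by rewrite (ord1 j) (ord1 (sval g r : 'I_1)).
pose u S (g : sieve_psh (boundary (linear 0)) S) : X S := False_rect _ (no_face S g).
have u_nat (S S' : ob Omega) (f : hom S S') g :
    u S (psh_map f g) = psh_map f (u S' g).
  by case: (no_face S' g).
have [S g|x px _] := cell_lift (y := y) (u := PMap u_nat).
  by case: (no_face S g).
by exists x.
Qed.

(** Lift the edges first: the boundary of the corolla is their disjoint union. *)
Lemma corolla_lift k (y : Y (corolla k)) : exists x, p _ x = y.
Proof.
have vx (e : edge (corolla k)) : exists z : X (linear 0),
    p _ z = psh_map (edge_incl e : hom (linear 0 : ob Omega) (corolla k : ob Omega)) y.
  exact: vertex_lift.
pose x e := sval (cid (vx e)); have px e := svalP (cid (vx e)).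
pose factors (S : tree) (g : hom (S : ob Omega) (corolla k : ob Omega)) e
  (h : hom (S : ob Omega) (linear 0 : ob Omega)) :=
  g = compm (edge_incl e : hom (linear 0 : ob Omega) (corolla k : ob Omega)) h.
have factors_unique S g e e' h h' : @factors S g e h -> factors S g e' h' ->
    e = e' /\ h = h'.
  move=> -> ge'; split.
    have [r _ _] := treeP S.
    exact: (congr1 (fun f : tree_hom S (corolla k) => f r) ge').
  by apply: tree_hom_eq => z; rewrite (ord1 (h z : 'I_1)) (ord1 (h' z : 'I_1)).
(* A corolla has no inner edge, so its only faces are its edges. *)
have factors_ex S (g : sieve_psh (boundary (corolla k)) S) :
    exists e h, factors S (sval g) e h.
  have [[e ei|e eo|e e1] _ [h ->]] := svalP g; last by exists e, h.
    by case: e ei h => [i|]; rewrite /inner.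
  case/andP: (eo) => _ /eqP; rewrite eq_card0 // => -[i|];
    by rewrite !inE /inner /= andbF.
have u_ex S (g : sieve_psh (boundary (corolla k)) S) : exists z : X S,
    forall e h, factors S (sval g) e h -> z = psh_map h (x e).
  have [e [h geh]] := factors_ex S g; exists (psh_map h (x e)) => e' h' geh'.
  by have [-> ->] := factors_unique _ _ _ _ _ _ geh geh'.
pose u S g := sval (cid (u_ex S g)); have uE S g := svalP (cid (u_ex S g)).
have u_nat (S S' : ob Omega) (f : hom S S') g :
    u S (psh_map f g) = psh_map f (u S' g).
  have [e [h geh]] := factors_ex S' g.
  rewrite /u (uE S' g e h geh) (uE S (psh_map f g) e (compm h f)) ?psh_comp //.
  rewrite /factors /= geh; exact/esym/(@compmA Omega).
have [S g|z pz _] := cell_lift (y := y) (u := PMap u_nat); last by exists z.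
have [e [h geh]] := factors_ex S g.
by rewrite [in RHS]geh psh_comp /= /u (uE S g e h geh) pmap_nat px.
Qed.

Section FixedVertex.
Variables (n : nat) (x : restr delta_omega X 0).

Lemma sphere_lift (b : sphere n (ip 0 x)) :
  exists a : sphere n x, sphere_map ip a = b.
Proof.
have [|k g gd|a pa ax] := simplex_lift (y := sval b)
  (u := fun k _ => const_simplex x k).
- by move=> k l g h _; rewrite psh_map_const.
- by rewrite (svalP b _ _ gd) const_simplex_map.
by exists (exist _ a ax); apply: sphere_eq.
Qed.

Lemma coface_factor k (g : hom (k : ob Delta) (n.+1 : ob Delta)) :
  non_surjective g -> exists i d, g = compm (coface i) d.
Proof.
move=> /misses_not_surj[j gj].
have gE i : lift j (odflt ord0 (unlift j (sval g i))) = sval g i.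
  by case: unliftP (gj i) => [i' ->|->] //; rewrite eqxx.
have d_mono (i i' : 'I_k.+1) : i <= i' ->
    odflt ord0 (unlift j (sval g i)) <= odflt ord0 (unlift j (sval g i')).
  move=> ii'; rewrite -(leq_bump2 j) -![bump _ _]/(nat_of_ord (lift j _)) !gE.
  exact: (svalP g).
exists j, (exist _ (fun i => odflt ord0 (unlift j (sval g i))) d_mono).
by apply: delta_hom_eq => i /=; rewrite gE.
Qed.

(** Spheres have constant facets, so any assignment of spheres to the facets of
an (n+1)-simplex is compatible on overlaps and prescribes a lift of its
boundary. *)
Lemma facets_lift (s : 'I_n.+2 -> sphere n x) (y : restr delta_omega Y n.+1) :
  (forall i, psh_map (coface i) y = ip n (sval (s i))) ->
  exists2 w : restr delta_omega X n.+1, ip n.+1 w = y &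
    forall i, psh_map (coface i) w = sval (s i).
Proof.
move=> ys.
(* Where two distinct facets overlap, both spheres are constant. *)
have s_agree k i i' (d d' : hom (k : ob Delta) (n : ob Delta)) :
    compm (coface i) d = compm (coface i') d' ->
    psh_map d (sval (s i)) = psh_map d' (sval (s i')).
  move=> dd'; have dd'E j : lift i (sval d j) = lift i' (sval d' j).
    exact: (congr1 (fun f => sval f j) dd').
  have [ii'|ii'] := eqVneq i i'.
    subst i'; congr psh_map; apply: delta_hom_eq => j; exact: lift_inj (dd'E j).
  have miss (a b : 'I_n.+2) (c c' : hom (k : ob Delta) (n : ob Delta)) :
      a != b -> (forall j, lift a (sval c j) = lift b (sval c' j)) ->
      psh_map c (sval (s a)) = const_simplex x k.
    move=> ab cc'; apply: (svalP (s a)); apply/misses_not_surj.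
    have [e be _] := unlift_some ab; exists e => j; apply/eqP => je.
    by have := neq_lift b (sval c' j); rewrite -cc' je -be eqxx.
  by rewrite (miss i i' d d') // (miss i' i d' d) // eq_sym.
(* When g is surjective it has no such factorization; the value is then
   arbitrary. *)
have u_ex k (g : hom (k : ob Delta) (n.+1 : ob Delta)) :
    exists z : restr delta_omega X k, forall i d, g = compm (coface i) d ->
      z = psh_map d (sval (s i)).
  have [[i [d gE]]|gN] := pselect (exists i d, g = compm (coface i) d).
    by exists (psh_map d (sval (s i))) => i' d' gE'; apply: s_agree; rewrite -gE.
  by exists (const_simplex x k) => i d gE; case: gN; exists i, d.
pose u k g := sval (cid (u_ex k g)).
have uE k i d : u k (compm (coface i) d) = psh_map d (sval (s i)).
  exact: (svalP (cid (u_ex k _))).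
have [k l g h /coface_factor[i [d ->]]|k g /coface_factor[i [d ->]]|w pw wu] :=
  simplex_lift (y := y) (u := u).
- by rewrite -compmA !uE psh_comp.
- by rewrite uE pmap_nat -ys psh_comp.
exists w => // i; rewrite wu; last first.
  apply/misses_not_surj; exists i => j; rewrite eq_sym; exact: neq_lift.
by rewrite -[coface i]compm1 uE psh_id.
Qed.

End FixedVertex.

End TrivialFibration.

(** * Isomorphisms on homotopy groups *)

Lemma bijective_inj_surj (A B : Type) (h : A -> B) :
  injective h -> (forall b, exists a, h a = b) -> bijective h.
Proof.
move=> h_inj h_surj; exists (fun b => sval (cid (h_surj b))) => [a|b].
  by apply: h_inj; case: cid.
by case: cid.
Qed.

Lemma homotopy_map_class (X Y : sset) (f : pmap X Y) n (x : X 0)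
    (a : sphere n x) :
  homotopy_map f (quot_class homotopic a) =
  quot_class homotopic (sphere_map f a).
Proof. exact: quotient_map_class. Qed.

Notation underlying := (restr delta_omega).
Notation umap := (restr_map delta_omega).

Definition pi_map n (X Y : dset) (f : pmap X Y) (x : underlying X 0) :
  homotopy_group n x -> homotopy_group n (umap f 0 x) :=
  @homotopy_map _ _ (umap f) n x.

Definition edge_vertex (X : dset) (T : tree) (e : edge T) (q : X T) :
  underlying X 0 :=
  psh_map (edge_incl e : hom (linear 0 : ob Omega) (T : ob Omega)) q.

Definition component (X : dset) (x a : underlying X 0) : homotopy_group 0 x :=
  quot_class homotopic (exist _ a (vertex_is_sphere x a)).

(** The operation [K_op] for an arbitrary dendroidal set in place of a fibrant
replacement: the intermediate objects of factorizations are not of that form. *)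
Definition pi_add n (X : dset) (x : underlying X 0) :
    homotopy_group n x -> homotopy_group n x -> homotopy_group n x -> Prop :=
  match n with
  | 0 => fun A B C => exists q : X (corolla 2),
      [/\ component x (edge_vertex (T := corolla 2) (Some ord0) q) = A,
          component x (edge_vertex (T := corolla 2) (Some ord_max) q) = B
        & component x (edge_vertex (T := corolla 2) None q) = C]
  | m.+1 => @homotopy_mul (underlying X) m.+1 x
  end.

Definition pi_iso_at n (X Y : dset) (f : pmap X Y) (x : underlying X 0) : Prop :=
  bijective (@pi_map n X Y f x) /\
  forall A B C : homotopy_group n x,
    pi_add A B C <-> pi_add (pi_map f A) (pi_map f B) (pi_map f C).

Definition pi_iso (X Y : dset) (f : pmap X Y) : Prop :=
  forall n x, @pi_iso_at n X Y f x.

Lemma component_map (X Y : dset) (f : pmap X Y) (x : underlying X 0) T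
    (e : edge T) (q : X T) :
  component (umap f 0 x) (edge_vertex e (f T q)) =
  pi_map f (component x (edge_vertex e q)).
Proof.
rewrite [RHS]homotopy_map_class; congr quot_class; apply: sphere_eq => /=.
exact/esym/pmap_nat.
Qed.

Lemma pi_add_map n (X Y : dset) (f : pmap X Y) (x : underlying X 0)
    (A B C : homotopy_group n x) :
  pi_add A B C -> pi_add (pi_map f A) (pi_map f B) (pi_map f C).
Proof.
case: n A B C => [|n] A B C /=.
  by case=> q [<- <- <-]; exists (f _ q); rewrite !component_map.
move=> [a [b [c [y [<- <- <- yP]]]]].
exists (sphere_map (umap f) a), (sphere_map (umap f) b), (sphere_map (umap f) c).
exists (umap f _ y); split; rewrite /pi_map ?homotopy_map_class // => i.
rewrite -pmap_nat yP; do 3!case: ifP => // _; exact: const_simplex_map.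
Qed.

Lemma pi_map_comp n (X Y Z : dset) (f : pmap X Y) (g : pmap Y Z)
    (x : underlying X 0) (A : homotopy_group n x) :
  pi_map (pcomp g f) A = pi_map g (pi_map f A).
Proof.
have [a <-] := quot_class_surj A; rewrite /pi_map !homotopy_map_class.
by congr quot_class; apply: sphere_eq.
Qed.

Lemma pi_iso_comp (X Y Z : dset) (f : pmap X Y) (g : pmap Y Z) :
  pi_iso f -> pi_iso g -> pi_iso (pcomp g f).
Proof.
move=> fi gi n x; have [fb fa] := fi n x; have [gb ga] := gi n (umap f 0 x).
split=> [|A B C]; last by rewrite fa ga -!pi_map_comp.
apply: (eq_bij (f := @pi_map n _ _ g (umap f 0 x) \o @pi_map n _ _ f x)).
  exact: bij_comp gb fb.
by move=> A; rewrite /= -pi_map_comp.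
Qed.

(** Any map preserves the operations; f also reflects them, because g preserves
them and g o f reflects them. *)
Lemma pi_iso_cancel (X Y Z : dset) (f : pmap X Y) (g : pmap Y Z) :
  pi_iso (pcomp g f) ->
  (forall n (x : underlying X 0), injective (@pi_map n _ _ g (umap f 0 x))) ->
  pi_iso f.
Proof.
move=> gfi g_inj n x; have [gfb gfa] := gfi n x.
split=> [|A B C]; last first.
  split; first exact: pi_add_map.
  by move=> /(pi_add_map g); rewrite -!pi_map_comp -gfa.
apply: bijective_inj_surj => [A A' AA'|B].
  by apply: (bij_inj gfb); rewrite !pi_map_comp AA'.
have [h _ hK] := gfb; exists (h (pi_map g B)); apply: g_inj.
by rewrite -pi_map_comp hK.
Qed.

Lemma pi_iso_inj (X Y : dset) (f : pmap X Y) : pi_iso f ->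
  forall n (x : underlying X 0), injective (@pi_map n _ _ f x).
Proof. by move=> fi n x; case: (fi n x) => /bij_inj. Qed.

Lemma pi_iso_two_of_six (X Y Z W : dset) (f : pmap X Y) (g : pmap Y Z)
    (h : pmap Z W) : pi_iso (pcomp g f) -> pi_iso (pcomp h g) -> pi_iso f.
Proof.
move=> gf hg; apply: pi_iso_cancel gf _ => n x A B AB.
by apply: (pi_iso_inj hg); rewrite !pi_map_comp AB.
Qed.

(** * Trivial fibrations are pi-isomorphisms *)

Section TrivialFibrationIso.
Variables (X Y : dset) (p : pmap X Y).
Hypothesis p_lifts : forall T : tree, lifts (sieve_incl (boundary T)) p.

Section At.
Variables (n : nat) (x : underlying X 0).

Lemma homotopic_lift (a b : sphere n x) :
  homotopic (sphere_map (umap p) a) (sphere_map (umap p) b) -> homotopic a b.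
Proof.
move=> [y yP].
pose s (i : 'I_n.+2) := if i == n.+1 :> nat then b
  else if i == n :> nat then a else const_sphere n x.
have [i|w _ wP] := facets_lift p_lifts (s := s) (y := y).
  rewrite yP /s; do 2!case: ifP => // _; exact/esym/const_simplex_map.
by exists w => i; rewrite wP /s; do 2!case: ifP => // _.
Qed.

(** A zigzag of homotopies between spheres is lifted one homotopy at a time,
after choosing lifts of the intermediate spheres.  At a trivial step the two lifts may
differ, and a degenerate homotopy is lifted. *)
Lemma equiv_closure_lift (c d : sphere n (umap p 0 x)) :
  equiv_closure homotopic c d ->
  forall a b : sphere n x, sphere_map (umap p) a = c ->
    sphere_map (umap p) b = d -> equiv_closure homotopic a b.
Proof.
elim=> {c d} [c d cd|c|c d _ IH|c d e _ IH1 _ IH2] a b ac bd.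
- by apply/EquivStep/homotopic_lift; rewrite ac bd.
- by apply/EquivStep/homotopic_lift; rewrite ac bd; apply: homotopic_refl.
- exact/EquivSym/IH.
- have [a' a'd] := sphere_lift p_lifts d.
  exact: EquivTrans (IH1 a a' ac a'd) (IH2 a' b a'd bd).
Qed.

Lemma pi_map_inj : injective (@pi_map n _ _ p x).
Proof.
move=> A B; have [a <-] := quot_class_surj A; have [b <-] := quot_class_surj B.
rewrite /pi_map !homotopy_map_class => /quot_class_eq ab.
by apply/quot_class_eq; apply: equiv_closure_lift ab _ _ _ _.
Qed.

Lemma pi_map_surj B : exists A, @pi_map n _ _ p x A = B.
Proof.
have [b <-] := quot_class_surj B; have [a <-] := sphere_lift p_lifts b.
by exists (quot_class homotopic a); rewrite -homotopy_map_class.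
Qed.

End At.

Lemma trivial_fibration_pi_iso : pi_iso p.
Proof.
move=> n x; split.
  exact: bijective_inj_surj (@pi_map_inj n x) (@pi_map_surj n x).
move=> A B C; split; first exact: pi_add_map.
case: n A B C => [|n] A B C.
  move=> [q [qA qB qC]]; have [q' q'q] := corolla_lift p_lifts q; subst q.
  by exists q'; split; apply: pi_map_inj; rewrite -component_map.
move=> [a' [b' [c' [y [aA bB cC yP]]]]].
have [a aE] := sphere_lift p_lifts a'; have [b bE] := sphere_lift p_lifts b'.
have [c cE] := sphere_lift p_lifts c'; subst a' b' c'.
pose s (i : 'I_n.+3) := if i == n.+2 :> nat then b
  else if i == n.+1 :> nat then c else if i == n.+1.-1 :> nat then a
  else const_sphere n.+1 x.
have [i|w _ wP] := facets_lift p_lifts (s := s) (y := y).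
  rewrite yP /s; do 3!case: ifP => // _; exact/esym/const_simplex_map.
exists a, b, c, w; split; last by move=> i; rewrite wP /s; do 3!case: ifP => // _.
all: by apply: pi_map_inj; rewrite [LHS]homotopy_map_class.
Qed.

End TrivialFibrationIso.

(** * Invariance under operadic equivalences *)

Section Main.
Variables (CM : model_structure Omega) (hCM : cisinski_moerdijk CM).
Variables (ST : model_structure Omega) (hST : stable ST).

Lemma boundary_cof (T : tree) : cof ST (sieve_incl (boundary T)).
Proof. by apply/hST.1 => P Pb _ _ _; apply: Pb. Qed.

Lemma tfib_pi_iso (X Y : dset) (p : pmap X Y) : tfib ST p -> pi_iso p.
Proof.
move=> [pf pw]; apply: trivial_fibration_pi_iso => T.
exact: cof_tfib_lifts (boundary_cof T) pf pw.
Qed.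

Lemma weq_fibrant_pi_iso (X Y : dset) (w : pmap X Y) :
  fibrant ST X -> fibrant ST Y -> weq ST w -> pi_iso w.
Proof.
move=> Xf Yf ww.
have [Z [j [s [p [sf pf sj <-]]]]] := weq_fibrant_factor Xf Yf ww.
have si := tfib_pi_iso sf.
apply: pi_iso_comp (tfib_pi_iso pf); apply: (pi_iso_cancel (g := s)).
  by rewrite sj; apply/tfib_pi_iso/tfib_pid.
by move=> n x; apply: pi_iso_inj.
Qed.

Variable R : fibrant_replacement ST.

Lemma repl_pi_iso (D D' : dset) (f : pmap D D') :
  weq ST f -> pi_iso (repl_map R f).
Proof.
move=> fw; apply: weq_fibrant_pi_iso; try exact: repl_fibrant.
apply: weq_cancell (repl_weq R D) _; rewrite repl_nat.
exact: weq_comp fw (repl_weq R D').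
Qed.

Lemma stable_cm_fibrant (D : dset) : fibrant ST D -> fibrant CM D.
Proof. by move=> /hST.2 Df; apply/hCM.2 => T a _; apply: Df. Qed.

Lemma same_cof X Y (f : pmap X Y) : cof CM f <-> cof ST f.
Proof. by rewrite hCM.1 hST.1. Qed.

(** The extension g of the unit of D along i is an inverse of R i up to weak
equivalence, as far as two-out-of-six is concerned. *)
Lemma tcof_repl_pi_iso (D D' : dset) (i : pmap D D') :
  cof CM i -> weq CM i -> pi_iso (repl_map R i).
Proof.
move=> ic iw.
have RDf := stable_cm_fibrant (repl_fibrant R D).
have [g gi] := fibrant_extend (repl_unit R D) RDf ic iw.
apply: (pi_iso_two_of_six (g := repl_map R g) (h := repl_map R (repl_map R i))).
  by rewrite -repl_comp gi; apply/repl_pi_iso/repl_weq.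
rewrite -repl_comp; apply: repl_pi_iso.
have RD'f := stable_cm_fibrant (repl_fibrant R D').
apply: (weq_of_agree same_cof RD'f ic iw (h := repl_unit R D')); last exact: repl_weq.
rewrite -repl_nat -gi; exact: pmap_eq.
Qed.

Lemma weq_repl_pi_iso (D D' : dset) (f : pmap D D') :
  weq CM f -> pi_iso (repl_map R f).
Proof.
move=> fw; have [Z [i [p [fE ic iw pf]]]] := factor_tcof_fib CM f.
rewrite fE in fw *; rewrite repl_comp; apply: pi_iso_comp.
  exact: tcof_repl_pi_iso.
apply: repl_pi_iso; have pw : weq CM p by apply: weq_cancell iw fw.
by have [] := tfib_transfer same_cof (conj pf pw).
Qed.

End Main.

Theorem corollary4p4
  (CM : model_structure Omega) (hCM : cisinski_moerdijk CM)
  (ST : model_structure Omega) (hST : stable ST)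
  (R : fibrant_replacement ST)
  (D D' : dset) (f : pmap D D') (hf : weq CM f)
  (n : nat) (x : Kspace R D 0) :
  K_iso (K_map (R := R) (n := n) f (x := x)).
Proof.
have [f_bij f_add] := weq_repl_pi_iso hCM hST (R := R) hf n x.
split; first exact: f_bij.
by case: n x f_bij f_add => [|n] x _.
Qed.
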